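(* Let $\mathbb{K}$ be $\mathbb{R}$ or $\mathbb{C}$, let $S\subset\mathbb{K}^n$ be a set consisting of $r$ distinct points, and let $f:(\mathbb{K}^n,S)\rightarrow(\mathbb{K}^p,0)$ be a multigerm satisfying $\delta(f)<\infty$. Then the map $tf:\theta_S(n)\rightarrow\theta_{n,S}(f)$, $tf(\xi)=df\circ\xi$, is injective.
   Context: All mappings are smooth, meaning of class $C^\infty$ if $\mathbb{K}=\mathbb{R}$ and holomorphic if $\mathbb{K}=\mathbb{C}$. A multigerm is a map-germ $f:(\mathbb{K}^n,S)\rightarrow(\mathbb{K}^p,0)$ where $S$ is a set of $r$ distinct points of $\mathbb{K}^n$ (so every point of $S$ is sent to $0$); it can be identified with the collection of its branches $\{f_k:(\mathbb{K}^n,0)\rightarrow(\mathbb{K}^p,0)\mid 1\le k\le r\}$. $C_{n,S}$ (resp. $C_{p,0}$) is the $\mathbb{K}$-algebra of function-germs $(\mathbb{K}^n,S)\rightarrow\mathbb{K}$ (resp. $(\mathbb{K}^p,0)\rightarrow\mathbb{K}$), and $m_{p,0}\subset C_{p,0}$ is the set of function-germs $(\mathbb{K}^p,0)\rightarrow(\mathbb{K},0)$, i.e. those vanishing at $0$. Let $f^*:C_{p,0}\rightarrow C_{n,S}$ be the $\mathbb{K}$-algebra homomorphism $f^*(\psi)=\psi\circ f$. Set $Q(f)=C_{n,S}/f^*m_{p,0}C_{n,S}$, where $f^*m_{p,0}C_{n,S}$ is the ideal of $C_{n,S}$ generated by $f^*m_{p,0}$, and $\delta(f)=\dim_{\mathbb{K}}Q(f)$.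 $\theta_{n,S}(f)$ is the $C_{n,S}$-module of germs (at $S$) of vector fields along $f$, identified with the direct sum of $p$ copies of $C_{n,S}$. $\theta_S(n)=\theta_{n,S}(\mathrm{id}_{(\mathbb{K}^n,S)})$ is the module of germs at $S$ of vector fields on $\mathbb{K}^n$. Here $df$ denotes the differential of $f$. *)

(* Defs.v *)
From HB Require Import structures.
From mathcomp Require Import all_boot all_order all_algebra.
From mathcomp Require Import complex.
From mathcomp Require Import all_classical all_reals all_analysis.

Set Implicit Arguments.
Unset Strict Implicit.
Unset Printing Implicit Defensive.

Import Order.TTheory GRing.Theory Num.Theory.
Import numFieldNormedType.Exports.

Local Open Scope classical_set_scope.
Local Open Scope ring_scope.
Local Open Scope quotient_scope.

Section LmodQuotient.
Variables (K : pzRingType) (V : lmodType K) (I : zmodClosed V).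
Hypothesis IZ : GRing.scaler_closed I.

(* IZ is recorded only so that the module structure can be inferred. *)
Definition lmod_quot of GRing.scaler_closed I : Type := Quotient.quot I.
Local Notation Q := (lmod_quot IZ).

HB.instance Definition _ := GRing.Zmodule.on Q.
HB.instance Definition _ : EqQuotient V (Quotient.equiv I) Q :=
  EqQuotient.on Q.

Definition lmod_quot_scale (a : K) (x : Q) : Q := \pi_Q (a *: repr x).

Fact pi_scale a : {morph \pi_Q : x / a *: x >-> lmod_quot_scale a x}.
Proof.
move=> x; apply/eqP; rewrite /lmod_quot_scale -Quotient.idealrBE -scalerBr IZ //.
by rewrite Quotient.idealrBE reprK.
Qed.

Let piD : {morph \pi_Q : x y / x + y}.
Proof. exact: (@Quotient.pi_add _ I). Qed.

Let scaleqA a b v : lmod_quot_scale a (lmod_quot_scale b v) = lmod_quot_scale (a * b) v.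
Proof. by rewrite -[v]reprK -(pi_scale b) -!pi_scale scalerA. Qed.

Let scaleq1 : left_id 1 lmod_quot_scale.
Proof. by move=> v; rewrite -[v in LHS]reprK -pi_scale scale1r reprK. Qed.

Let scaleqDr : right_distributive lmod_quot_scale +%R.
Proof.
move=> a u v; rewrite -[u]reprK -[v]reprK -piD -!pi_scale scalerDr.
exact: piD.
Qed.

Let scaleqDl v : {morph lmod_quot_scale^~ v : a b / a + b}.
Proof. by move=> a b /=; rewrite -[v]reprK -!pi_scale scalerDl; exact: piD. Qed.

HB.instance Definition _ := GRing.Zmodule_isLmodule.Build K Q
  scaleqA scaleq1 scaleqDr scaleqDl.

End LmodQuotient.

Section Dimension.
Variables (R : realType) (K : pzRingType) (V : lmodType K).

Definition is_basis (d : nat) (e : 'I_d -> V) : Prop :=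
  (forall v, exists c : 'I_d -> K, v = \sum_(i < d) c i *: e i) /\
  (forall c : 'I_d -> K, \sum_(i < d) c i *: e i = 0 -> forall i, c i = 0).

(* The infimum of the empty set is +oo, so the dimension of a space without
   finite basis is +oo. *)
Definition dim : \bar R :=
  ereal_inf [set d%:R%:E | d in [set d : nat | exists e : 'I_d -> V, is_basis e]].

End Dimension.

Section Germ.
Variables (T : topologicalType) (S : set T).

Section Zmod.
Variable W : zmodType.

Definition null_germ : {pred T -> W} :=
  fun f => `[< set_nbhs S [set x | f x = 0] >].

Lemma null_germP f :
  reflect (set_nbhs S [set x | f x = 0]) (f \in null_germ).
Proof. exact: asboolP. Qed.

Fact null_germ_zmod_closed : zmod_closed null_germ.
Proof.
split=> [|f g /null_germP f0 /null_germP g0]; apply/null_germP.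
  exact: filterE.
by apply: filterS2 f0 g0 => x /= fx gx; rewrite !fctE fx gx subr0.
Qed.
HB.instance Definition _ :=
  GRing.isZmodClosed.Build (T -> W) null_germ null_germ_zmod_closed.

(* A germ at S is represented by total functions; a function defined only near
   S is extended by any values. *)
Definition germ : Type := Quotient.quot null_germ.

HB.instance Definition _ := GRing.Zmodule.on germ.
HB.instance Definition _ : EqQuotient (T -> W) (Quotient.equiv null_germ) germ :=
  EqQuotient.on germ.

Definition germ_of (f : T -> W) : germ := \pi_germ f.

Lemma eq_germP (f g : T -> W) :
  germ_of f = germ_of g <-> set_nbhs S [set x | f x = g x].
Proof.
have -> : germ_of f = germ_of g <-> f - g \in null_germ.
  by rewrite Quotient.idealrBE; split=> [/eqP|/eqP].
split=> [/null_germP|fg]; last apply/null_germP.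
  by apply: filterS => x /= /eqP; rewrite !fctE subr_eq0 => /eqP.
by apply: filterS fg => x /= fgx; rewrite !fctE fgx subrr.
Qed.

Lemma germ_ofK (g : germ) : germ_of (repr g) = g.
Proof. exact: reprK. Qed.

Lemma germ_ofD (f g : T -> W) : germ_of (f + g) = germ_of f + germ_of g.
Proof. exact: (@Quotient.pi_add _ null_germ f g). Qed.

Lemma germ_of0 : germ_of 0 = 0.
Proof. by apply: (addrI (germ_of 0)); rewrite -germ_ofD !addr0. Qed.

(* Independent of the representative when S x. *)
Definition germ_val (g : germ) (x : T) : W := repr g x.

Lemma germ_valE (f : T -> W) (x : T) : S x -> germ_val (germ_of f) x = f x.
Proof.
by move=> Sx; have /eq_germP/(_ _ Sx)/nbhs_singleton := germ_ofK (germ_of f).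
Qed.

End Zmod.

Section Lmod.
Variables (K : pzRingType) (W : lmodType K).

Fact null_germ_scaler_closed : GRing.scaler_closed (@null_germ W).
Proof.
move=> a f /null_germP f0; apply/null_germP.
by apply: filterS f0 => x /= fx; rewrite !fctE fx scaler0.
Qed.
HB.instance Definition _ :=
  GRing.Lmodule.copy (germ W) (lmod_quot null_germ_scaler_closed).

Lemma germ_ofZ (a : K) (f : T -> W) : germ_of (a *: f) = a *: germ_of f.
Proof. exact: pi_scale. Qed.

End Lmod.

Section Ring.
Variable W : comPzRingType.
Implicit Types g h : germ W.

Definition germ_mul g h : germ W := germ_of (repr g * repr h).

Let germ_ofM (f g : T -> W) : germ_of (f * g) = germ_mul (germ_of f) (germ_of g).
Proof.
apply/eq_germP; have /eq_germP f1 := germ_ofK (germ_of f).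
have /eq_germP g1 := germ_ofK (germ_of g).
by apply: filterS2 f1 g1 => x /= fx gx; rewrite !fctE fx gx.
Qed.

Let mulA : associative germ_mul.
Proof.
by move=> a b c; rewrite -[a]germ_ofK -[b]germ_ofK -[c]germ_ofK -!germ_ofM mulrA.
Qed.
Let mulC : commutative germ_mul.
Proof. by move=> a b; rewrite -[a]germ_ofK -[b]germ_ofK -!germ_ofM mulrC. Qed.
Let mul1 : left_id (germ_of 1) germ_mul.
Proof. by move=> a; rewrite -[a]germ_ofK -germ_ofM mul1r. Qed.
Let mulD : left_distributive germ_mul +%R.
Proof.
move=> a b c; rewrite -[a]germ_ofK -[b]germ_ofK -[c]germ_ofK.
by rewrite -germ_ofD -!germ_ofM mulrDl germ_ofD.
Qed.

HB.instance Definition _ := GRing.Zmodule_isComPzRing.Build (germ W)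
  mulA mulC mul1 mulD.

Lemma mul_germE (f g : T -> W) : germ_of f * germ_of g = germ_of (f * g).
Proof. by rewrite germ_ofM. Qed.

End Ring.

Lemma mul_germ_scaler (K : comPzRingType) (a : K) (g h : germ K^o) :
  a *: (g * h) = g * (a *: h).
Proof.
have [f <-] : exists f, germ_of f = g by exists (repr g); exact: germ_ofK.
have [f' <-] : exists f, germ_of f = h by exists (repr h); exact: germ_ofK.
rewrite mul_germE -!(@germ_ofZ K K^o) mul_germE.
by congr germ_of; apply/funext => x; exact: mulrCA.
Qed.

End Germ.

Variant scalar_kind := RealScalars | ComplexScalars.

Lemma near_eq_differentiable (K : numFieldType) (V W : normedModType K)
    (f g : V -> W) (x : V) :
  (\near x, f x = g x) -> differentiable f x ->
  differentiable g x /\ 'd g x = 'd f x :> (V -> W).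
Proof.
move=> fg df; have cdf : continuous ('d f x) by exact: diff_continuous.
have gE : g \o shift x = cst (g x) + 'd f x +o_ 0 id.
  have /eqaddoP fE := diff_locally df; apply/eqaddoP => e e0.
  have fgx : f x = g x by exact: nbhs_singleton fg.
  have fg0 : \forall z \near (0 : V), f (z + x) = g (z + x).
    suff : shift x @ (0 : V) --> x by move=> /(_ _ fg).
    rewrite -[X in _ --> X](add0r x).
    by apply: cvgD; [exact: cvg_id | exact: cvg_cst].
  by apply: filterS2 fg0 (fE e e0) => y /= fgy; rewrite !fctE /= fgx fgy.
have dg : 'd g x = 'd f x :> (V -> W) by exact: diff_unique.
by split=> //; apply/diff_locallyP; rewrite dg.
Qed.

Lemma near_eq_diff_comp (K : numFieldType) (V W : normedModType K) (S : set V)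
    (F G : V -> W) (X Y : V -> V) :
  germ_of S F = germ_of S G -> germ_of S X = germ_of S Y ->
  set_nbhs S [set x | differentiable F x] ->
  germ_of S (fun x => 'd F x (X x)) = germ_of S (fun x => 'd G x (Y x)).
Proof.
move=> /eq_germP/set_nbhsP[U [oU SU FG]] /eq_germP XY dF.
have nU : set_nbhs S U by apply/set_nbhsP; exists U; split.
apply/eq_germP; apply: filterS3 nU XY dF => x Ux /= <- dFx.
have FGx : \near x, F x = G x by apply: filterS (open_nbhs_nbhs (conj oU Ux)).
by have [_ ->] := near_eq_differentiable FGx dFx.
Qed.

Section Differentiability.
Variables (K : numFieldType) (V W : normedModType K).
Implicit Types (U : set V) (f g : V -> W).

(* C^m on an open set U, for V finite-dimensional *)
Fixpoint Ck (m : nat) U f : Prop :=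
  if m is m'.+1 then
    (forall x, U x -> differentiable f x) /\
    (forall v, Ck m' U (fun x => 'D_v f x))
  else forall x, U x -> {for x, continuous f}.

Definition Cinfty U f : Prop := forall m, Ck m U f.

Definition holomorphic U f : Prop := forall x, U x -> differentiable f x.

Lemma Ck_eq m U f g : open U -> (forall x, U x -> f x = g x) ->
  Ck m U f -> Ck m U g.
Proof.
move=> oU; elim: m f g => [|m IH] f g fg.
  move=> cf x Ux; have fgx : \near x, f x = g x.
    by apply: filterS (open_nbhs_nbhs (conj oU Ux)).
  rewrite /prop_for /continuous_at -(fg _ Ux).
  exact: cvg_trans (near_eq_cvg fgx) (cf x Ux).
have fgn x : U x -> \near x, f x = g x.
  by move=> Ux; apply: filterS (open_nbhs_nbhs (conj oU Ux)).
move=> [df Df]; split=> [x Ux|v].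
  by have [] := near_eq_differentiable (fgn x Ux) (df x Ux).
by apply: IH (Df v) => x Ux; apply: near_eq_derive; exact: fgn.
Qed.

Lemma Ck_subset m U U' f : U' `<=` U -> Ck m U f -> Ck m U' f.
Proof.
move=> UU; elim: m f => [|m IH] f /=; first by move=> cf x /UU; exact: cf.
by move=> [df Df]; split=> [x /UU|v]; [exact: df | exact: IH (Df v)].
Qed.

Lemma Ck_lin m U (a : K) f g : open U ->
  Ck m U f -> Ck m U g -> Ck m U (a *: f + g).
Proof.
move=> oU; elim: m f g => [|m IH] f g /=.
  move=> cf cg x Ux; apply: continuousD; last exact: cg.
  by apply: cvgZr; exact: cf.
move=> [df Df] [dg Dg]; split=> [x Ux|v].
  by apply: differentiableD; [apply: differentiableZ; exact: df | exact: dg].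
apply: (@Ck_eq _ _ (a *: (fun x => 'D_v f x) + (fun x => 'D_v g x))) => //.
  move=> x Ux; have dfx := diff_derivable (df x Ux) (v := v).
  rewrite deriveD; last exact/diff_derivable/dg.
    by rewrite (deriveZ a dfx).
  by apply: diff_derivable; apply: differentiableZ; exact: df.
exact: IH.
Qed.

Lemma Ck_cst m U (a : W) : Ck m U (cst a).
Proof.
elim: m a => [|m IH] a /=; first by move=> x _; exact: cvg_cst.
split=> [x _|v]; first exact: differentiable_cst.
rewrite (_ : (fun _ => _) = cst 0) //.
by apply/funext => x; rewrite derive_cst.
Qed.

Definition smooth_on (k : scalar_kind) U f : Prop :=
  match k with
  | RealScalars => Cinfty U f
  | ComplexScalars => holomorphic U f
  end.

Lemma smooth_on_differentiable k U f x :
  smooth_on k U f -> U x -> differentiable f x.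
Proof. by case: k => [/(_ 1%N)[sf _]|sf]; exact: sf. Qed.

Lemma smooth_on_eq k U f g : open U -> (forall x, U x -> f x = g x) ->
  smooth_on k U f -> smooth_on k U g.
Proof.
move=> oU fg; case: k => [sf m|sf x Ux]; first exact: Ck_eq (sf m).
have fgx : \near x, f x = g x by apply: filterS (open_nbhs_nbhs (conj oU Ux)).
by have [] := near_eq_differentiable fgx (sf x Ux).
Qed.

Lemma smooth_on_cst k U (a : W) : smooth_on k U (cst a).
Proof.
case: k => [m|x _]; [exact: Ck_cst | exact: differentiable_cst].
Qed.

Lemma smooth_on_subset k U U' f : U' `<=` U -> smooth_on k U f -> smooth_on k U' f.
Proof.
by move=> UU; case: k => /= sf x; [exact: Ck_subset (sf x) | move/UU; exact: sf].
Qed.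

Lemma smooth_on_lin k U (a : K) f g : open U ->
  smooth_on k U f -> smooth_on k U g -> smooth_on k U (a *: f + g).
Proof.
move=> oU; case: k => /= [sf sg m|sf sg x Ux]; first exact: Ck_lin.
by apply: differentiableD; [apply: differentiableZ; exact: sf | exact: sg].
Qed.

End Differentiability.

Definition scalars (R : realType) (k : scalar_kind) : numFieldType :=
  match k with RealScalars => R | ComplexScalars => R[i]%C end.

Section Smooth.
Variables (R : realType) (k : scalar_kind).
Local Notation K := (scalars R k).

Section SmoothGerm.
Variables (V : normedModType K) (S : set V) (W : normedModType K).

Definition smooth_near (f : V -> W) : Prop :=
  exists U, [/\ open U, S `<=` U & smooth_on k U f].

Definition smooth_germs : {pred germ S W} :=
  fun g => `[< exists2 f, smooth_near f & germ_of S f = g >].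

Fact smooth_germs_submod_closed : GRing.submod_closed smooth_germs.
Proof.
split.
  apply/asboolP; exists (cst 0); last exact: germ_of0.
  by exists setT; split=> //; [exact: openT | exact: smooth_on_cst].
move=> a _ _ /asboolP[f [U [oU SU sf]] <-] /asboolP[g [U' [oU' SU' sg]] <-].
apply/asboolP; exists (a *: f + g).
  exists (U `&` U'); split; first exact: (@openI _ U U').
    by move=> x Sx; split; [exact: SU | exact: SU'].
  apply: smooth_on_lin; first exact: openI.
    by apply: smooth_on_subset sf => x [].
  by apply: smooth_on_subset sg => x [].
by rewrite germ_ofD germ_ofZ.
Qed.

Lemma smooth_near_repr g : g \in smooth_germs -> smooth_near (repr g).
Proof.
move=> /asboolP[f [U [oU SU sf]] <-].
have /eq_germP/set_nbhsP[U' [oU' SU' fE]] := germ_ofK (germ_of S f).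
exists (U `&` U'); split; first exact: (@openI _ U U').
  by move=> x Sx; split; [exact: SU | exact: SU'].
apply: (@smooth_on_eq _ _ _ _ _ f); first exact: openI.
  by move=> x [_ /fE].
by apply: smooth_on_subset sf => x [].
Qed.

HB.instance Definition _ := GRing.isSubmodClosed.Build K (germ S W) smooth_germs
  (GRing.submod_closed_semi smooth_germs_submod_closed).

Definition smooth_germ : Type := {g : germ S W | g \in smooth_germs}.

HB.instance Definition _ := SubChoice.on smooth_germ.
HB.instance Definition _ := [SubChoice_isSubLmodule of smooth_germ by <:].

End SmoothGerm.

Section Multigerm.
Variables (n p : nat) (S : set 'rV[K]_n) (f : smooth_germ S 'rV[K]_p).
Local Notation origin := [set 0 : 'rV[K]_p].

(* smooth_germ S K^o is C_{n,S}, smooth_germ origin K^o is C_{p,0} and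
   smooth_germ S 'rV[K]_n is theta_S(n).  The germ f^*(psi) = psi o f and the
   germ df o xi below are computed on representatives; pullbackE and tfE show
   that the choice is immaterial. *)
Definition pullback (psi : smooth_germ origin K^o) : germ S K^o :=
  germ_of S (repr (val psi) \o repr (val f)).

Lemma pullbackE (psi : smooth_germ origin K^o) (F : 'rV[K]_n -> 'rV[K]_p) (P : 'rV[K]_p -> K^o) :
  (forall s, S s -> germ_val (val f) s = 0) ->
  germ_of S F = val f -> germ_of origin P = val psi ->
  pullback psi = germ_of S (P \o F).
Proof.
move=> f0 FE PE; apply/eq_germP.
have /eq_germP Ff : germ_of S F = germ_of S (repr (val f)) by rewrite germ_ofK.
have /eq_germP Pp : germ_of origin P = germ_of origin (repr (val psi)).
  by rewrite germ_ofK.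
have [U [_ SU sf]] := smooth_near_repr (valP f).
move=> s Ss; have cf : {for s, continuous (repr (val f))}.
  by apply: differentiable_continuous; apply: smooth_on_differentiable sf (SU _ Ss).
have f0s : repr (val f) s = 0 by exact: f0.
have P0 : nbhs (repr (val f) s) [set y | P y = repr (val psi) y].
  by rewrite f0s; have := Pp 0 erefl.
have Pf : \forall x \near s, P (repr (val f) x) = repr (val psi) (repr (val f) x).
  exact: (cf _ P0).
have Fs : \forall x \near s, F x = repr (val f) x by exact: (Ff s Ss).
by apply: filterS2 Pf Fs => x /= Px ->.
Qed.

(* The ideal of C_{n,S} generated by the f^*(psi), psi vanishing at 0; products
   are taken in the ring of all function-germs at S. *)
Definition pullback_ideal : {pred smooth_germ S K^o} :=
  fun g => `[< exists (l : nat) (psi : 'I_l -> smooth_germ origin K^o)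
                      (h : 'I_l -> smooth_germ S K^o),
                 (forall i, germ_val (val (psi i)) 0 = 0) /\
                 val g = \sum_(i < l) pullback (psi i) * val (h i) >].

Fact pullback_ideal_zmod_closed : zmod_closed pullback_ideal.
Proof.
split.
  apply/asboolP; exists 0%N, (fun=> 0), (fun=> 0); split; first by case.
  by rewrite big_ord0.
move=> g g' /asboolP[l [psi [h [psi0 gE]]]] /asboolP[l' [psi' [h' [psi'0 g'E]]]].
apply/asboolP; exists (l + l')%N.
exists (fun i : 'I_(l + l') => match fintype.split i with inl j => psi j | inr j => psi' j end).
exists (fun i : 'I_(l + l') => match fintype.split i with inl j => h j | inr j => - h' j end).
split=> [i|]; first by case: fintype.split.
have -> : val (g - g') = val g - val g' by exact: (raddfB val).
rewrite gE g'E big_split_ord -sumrN; congr (_ + _).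
  apply: eq_bigr => i _; rewrite -[lshift _ _]/(unsplit (inl i)) unsplitK.
  by [].
apply: eq_bigr => i _; rewrite -[rshift _ _]/(unsplit (inr i)) unsplitK.
rewrite -mulrN; congr (_ * _); exact: (raddfN val).
Qed.
HB.instance Definition _ :=
  GRing.isZmodClosed.Build (smooth_germ S K^o) pullback_ideal
    pullback_ideal_zmod_closed.

Fact pullback_ideal_scaler_closed : @GRing.scaler_closed K _ pullback_ideal.
Proof.
move=> a g /asboolP[l [psi [h [psi0 gE]]]]; apply/asboolP.
exists l, psi, (fun i => a *: h i); split=> //.
have valZ (b : K) (u : smooth_germ S K^o) : val (b *: u) = b *: val u.
  by [].
rewrite valZ gE scaler_sumr; apply: eq_bigr => i _.
by rewrite valZ mul_germ_scaler.
Qed.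

Definition Q_alg : Type := lmod_quot pullback_ideal_scaler_closed.

HB.instance Definition _ :=
  GRing.Lmodule.copy Q_alg (lmod_quot pullback_ideal_scaler_closed).

Definition delta : \bar R := @dim R K Q_alg.

(* The codomain germ S 'rV[K]_p, all map-germs, contains theta_{n,S}(f), which
   is its submodule smooth_germs S 'rV[K]_p. *)
Definition tf (xi : smooth_germ S 'rV[K]_n) : germ S 'rV[K]_p :=
  germ_of S (fun x => 'd (repr (val f)) x (repr (val xi) x)).

Lemma tfE xi (F : 'rV[K]_n -> 'rV[K]_p) (X : 'rV[K]_n -> 'rV[K]_n) :
  germ_of S F = val f -> germ_of S X = val xi ->
  tf xi = germ_of S (fun x => 'd F x (X x)).
Proof.
move=> FE XE; apply: near_eq_diff_comp; rewrite ?germ_ofK //.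
have [U [oU SU sf]] := smooth_near_repr (valP f).
apply/set_nbhsP; exists U; split=> // x Ux.
exact: smooth_on_differentiable sf Ux.
Qed.

End Multigerm.

End Smooth.

(* Main.v *)
Require Import Defs.
From HB Require Import structures.
From mathcomp Require Import all_boot all_order all_algebra.
From mathcomp Require Import complex.
From mathcomp Require Import all_classical all_reals all_analysis.
From mathcomp Require Import ring lra zify.

(** Let [d] be the dimension of [Q(f)] and let [X] be the difference of two
    vector fields with the same image under [tf], so that [df(X) = 0] near a
    point [s] of [S].  Since [Q(f)] has dimension [d], every monomial [m] of
    degree at most [d] satisfies, near [s],
      [m = sum_i c_i e_i + sum_j psi_j(f) h_j]
    with fixed [e_1, ..., e_d] and [psi_j(0) = 0].  Suppose that [X(x) <> 0] for
    some [x] close to [s].  Along a polynomial curve through [x] that solves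
    [g' = X(g)] to order [d], [f] is constant up to order [d + 1].  Some nonzero
    combination [Lam] of the Taylor coefficients of order [0, ..., d] along this
    curve kills all the [e_i], so that [Lam m = sum_j psi_j(f(x)) Lam h_j].
    Replacing [h_j] by its Taylor polynomial at [x], whose coefficients are
    bounded uniformly in [x], gives [M <= eps * M] for
    [M = sum_m |Lam m|], where [eps < 1] once [x] is close to [s].  Hence [Lam]
    kills all these monomials, in particular the powers of a coordinate which is
    a local parameter on the curve, and so [Lam = 0], a contradiction.

    This only needs Taylor expansions.  In the holomorphic case, where functions
    are merely assumed to be complex differentiable, they follow from Cauchy's
    estimate [|f'(0)| <= C sup |f| / r], which is obtained from Goursat's
    bisection argument with Riemann sums instead of contour integrals.  The
    estimate, applied to second differences, shows that the derivative is
    again complex differentiable. *)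

Set Implicit Arguments.
Unset Strict Implicit.
Unset Printing Implicit Defensive.

Import Order.TTheory GRing.Theory Num.Theory.
Import numFieldNormedType.Exports.

Local Open Scope classical_set_scope.
Local Open Scope ring_scope.
Local Open Scope quotient_scope.

(** * Formal integral curves *)

Section Formal.
Variable K : numFieldType.
Implicit Types p q : {poly K}.

(* p = q modulo 'X^m *)
Definition eqlow m p q := forall i, (i < m)%N -> p`_i = q`_i.

Lemma eqlow_le m m' p q : (m' <= m)%N -> eqlow m p q -> eqlow m' p q.
Proof. by move=> mm pq i im; apply: pq; exact: leq_trans im mm. Qed.

Lemma eqlowM m p p' q q' :
  eqlow m p p' -> eqlow m q q' -> eqlow m (p * q) (p' * q').
Proof.
move=> pp qq i im; rewrite !coefM; apply: eq_bigr => j _.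
have ji : (j <= i)%N by rewrite -ltnS.
by rewrite pp ?qq //; [exact: leq_ltn_trans (leq_subr _ _) im | exact: leq_ltn_trans im].
Qed.

Lemma eqlow_sum m (I : Type) (r : seq I) (F G : I -> {poly K}) :
  (forall i, eqlow m (F i) (G i)) -> eqlow m (\sum_(i <- r) F i) (\sum_(i <- r) G i).
Proof.
by move=> FG i im; rewrite !coef_sum; apply: eq_bigr => j _; exact: FG.
Qed.

Lemma eqlowZ m (a : K) p q : eqlow m p q -> eqlow m (a *: p) (a *: q).
Proof. by move=> pq i im; rewrite !coefZ pq. Qed.

(** The coefficient at [i = 0] is a division by 0, whose value is 0 by convention, so the primitive
    vanishes at the origin. *)
Definition primitive p := \poly_(i < (size p).+1) (p`_i.-1 / i%:R).

Lemma coef_primitive p i : (primitive p)`_i = p`_i.-1 / i%:R.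
Proof.
rewrite coef_poly; case: ltnP => // pi.
by rewrite nth_default ?mul0r // -ltnS; case: i pi.
Qed.

Lemma deriv_primitive p : (primitive p)^`() = p.
Proof.
apply/polyP => i; rewrite coef_deriv coef_primitive /= -[LHS]mulr_natr.
by rewrite divfK // pnatr_eq0.
Qed.

Lemma eqlow_primitive m p q : eqlow m p q -> eqlow m.+1 (primitive p) (primitive q).
Proof.
move=> pq [|i] im; rewrite !coef_primitive; last by rewrite pq.
by rewrite !invr0 !mulr0.
Qed.

Section Curve.
Variables n M : nat.

(* Monomials are encoded by the words of their variables. *)
Definition mon (w : seq 'I_n) (y : 'rV[K]_n) : K := \prod_(a <- w) y 0 a.

Definition pmon (w : seq 'I_n) (g : 'I_n -> {poly K}) : {poly K} :=
  \prod_(a <- w) g a.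

Lemma horner_pmon w g t : (pmon w g).[t] = mon w (\row_a (g a).[t]).
Proof. by rewrite horner_prod; apply: eq_bigr => a _; rewrite mxE. Qed.

Lemma eqlow_pmon m w g g' :
  (forall a, eqlow m (g a) (g' a)) -> eqlow m (pmon w g) (pmon w g').
Proof.
move=> gg; rewrite /pmon; elim: w => [|a w IH]; first by rewrite !big_nil.
by rewrite !big_cons; apply: eqlowM.
Qed.

(** Words of length at most [M] form a finite type indexing the monomials of degree at most [M].
    Several words may encode one monomial; their coefficients simply add up. *)
Definition psum (c : M.-bseq 'I_n -> K) (g : 'I_n -> {poly K}) : {poly K} :=
  \sum_w c w *: pmon w g.

Lemma eqlow_psum m c g g' :
  (forall a, eqlow m (g a) (g' a)) -> eqlow m (psum c g) (psum c g').
Proof. by move=> gg; apply: eqlow_sum => w; apply: eqlowZ; exact: eqlow_pmon. Qed.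

Lemma horner_psum c g t :
  (psum c g).[t] = \sum_w c w * mon w (\row_a (g a).[t]).
Proof.
by rewrite horner_sum; apply: eq_bigr => w _; rewrite hornerZ horner_pmon.
Qed.

(* Picard iteration, each step of which fixes one more coefficient. *)
Lemma formal_curve (c : 'I_n -> M.-bseq 'I_n -> K) (x : 'rV[K]_n) N :
  exists g : 'I_n -> {poly K}, (forall a, (g a)`_0 = x 0 a) /\
    (forall a, eqlow N (g a)^`() (psum (c a) g)).
Proof.
pose G := fix G (m : nat) (a : 'I_n) : {poly K} :=
  if m is m'.+1 then (x 0 a)%:P + primitive (psum (c a) (G m')) else (x 0 a)%:P.
have G0 m a : (G m a)`_0 = x 0 a.
  case: m => [|m] /=; first by rewrite coefC.
  by rewrite coefD coefC coef_primitive invr0 mulr0 addr0.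
(* Integration gains one order, so consecutive iterates agree to an order that grows with [m]. *)
have GS m a : eqlow m.+1 (G m.+1 a) (G m a).
  elim: m a => [|m IH] a; first by case=> // _; rewrite !G0.
  move=> i im; rewrite [G m.+2]/= [G m.+1 in RHS]/= !coefD; congr (_ + _).
  by apply: eqlow_primitive im; apply: eqlow_psum.
exists (G N); split=> [a|a]; first exact: G0.
case: N => [|N] // i iN; rewrite /= derivD derivC add0r deriv_primitive.
by apply: (@eqlow_psum N.+1) => // b j jN; rewrite GS.
Qed.

End Curve.

(** These are [N] homogeneous linear equations in [N + 1] unknowns. *)
Lemma exists_functional N (A : 'I_N -> nat -> K) :
  exists lam : 'I_N.+1 -> K, (exists i, lam i != 0) /\
    (forall j, \sum_(i < N.+1) lam i * A j i = 0).
Proof.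
pose B := \matrix_(i < N.+1, j < N) A j i.
have kB : kermx B != 0.
  by rewrite -mxrank_eq0 mxrank_ker -lt0n subn_gt0 ltnS rank_leq_col.
have /rowV0Pn[v /sub_kermxP vB v0] := kB.
exists (fun i => v 0 i); split.
  apply/existsP; apply: contraNT v0; rewrite negb_exists => /forallP v0.
  by apply/eqP/rowP => i; rewrite mxE; apply/eqP; rewrite -[_ == _]negbK.
move=> j; have /rowP/(_ j) := vB; rewrite !mxE => vBj; rewrite -[RHS]vBj.
by apply: eq_bigr => i _; rewrite mxE.
Qed.

Definition pairing N (lam : 'I_N.+1 -> K) (p : {poly K}) : K :=
  \sum_(i < N.+1) lam i * p`_i.

Section Pairing.
Variables (N : nat) (lam : 'I_N.+1 -> K).

Lemma pairingD p q : pairing lam (p + q) = pairing lam p + pairing lam q.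
Proof.
by rewrite -big_split; apply: eq_bigr => i _; rewrite coefD mulrDr.
Qed.

Lemma pairingZ a p : pairing lam (a *: p) = a * pairing lam p.
Proof. by rewrite mulr_sumr; apply: eq_bigr => i _; rewrite coefZ mulrCA. Qed.

Lemma pairing_sum (I : Type) (r : seq I) (F : I -> {poly K}) :
  pairing lam (\sum_(i <- r) F i) = \sum_(i <- r) pairing lam (F i).
Proof.
apply: (big_morph _ pairingD).
by rewrite /pairing big1 // => i _; rewrite coef0 mulr0.
Qed.

Lemma pairing_eqlow p q : eqlow N.+1 p q -> pairing lam p = pairing lam q.
Proof. by move=> pq; apply: eq_bigr => i _; rewrite pq. Qed.

(* The powers of a local parameter separate the coefficients of order <= N. *)
Lemma pairing_expr_eq0 (g : {poly K}) : g`_1 != 0 ->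
  (forall i, (i <= N)%N -> pairing lam (g ^+ i) = 0) -> forall i, lam i = 0.
Proof.
move=> g1 lg; pose u := g - (g`_0)%:P.
have [v uE] : exists v, u = v * 'X.
  have /factor_theorem[v] : root u 0.
    by rewrite /root /u hornerD hornerN hornerC horner_coef0 subrr.
  by rewrite subr0 => ->; exists v.
have v0 : v`_0 != 0.
  have : u`_1 = g`_1 by rewrite /u coefB coefC subr0.
  by rewrite uE coefMX /= => ->.
have lu i : (i <= N)%N -> pairing lam (u ^+ i) = 0.
  move=> iN; rewrite /u exprBn pairing_sum big1 // => j _.
  rewrite (_ : _ *+ _ = ((-1) ^+ j * g`_0 ^+ j *+ 'C(i, j)) *: g ^+ (i - j)).
    by rewrite pairingZ lg ?mulr0 // (leq_trans (leq_subr _ _)).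
  by rewrite -mul_polyC polyCMn polyCM !polyC_exp polyCN mulrnAl mulrAC.
move=> i0; apply/eqP; apply: contraT => li0.
case: (@arg_maxnP _ i0 (fun i => lam i != 0) val li0) => i li imax.
have := lu i; rewrite -ltnS ltn_ord => /(_ isT) /eqP.
rewrite /pairing (bigD1 i) //= big1 ?addr0; last first.
  move=> j ji; have [ij|ij] := ltnP j i.
    by rewrite uE exprMn_comm ?coefMXn ?ij ?mulr0 //; exact: mulrC.
  have [->|/imax] := eqVneq (lam j) 0; first by rewrite mul0r.
  by move=> ji'; case/negP: ji; apply/eqP/val_inj/eqP; rewrite eqn_leq ij andbT.
rewrite uE exprMn_comm; last exact: mulrC.
rewrite coefMXn ltnn subnn -horner_coef0 horner_exp horner_coef0.
by rewrite mulf_eq0 expf_eq0 (negPf li) (negPf v0) andbF.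
Qed.
End Pairing.
End Formal.

(** * Mean value inequality *)

Lemma exists_div_exp2_lt (R : archiRealFieldType) (s d : R) : 0 <= s -> 0 < d ->
  exists k, s / 2 ^+ k < d.
Proof.
move=> s0 d0; have /archi_boundP : 0 <= s / d by rewrite divr_ge0 // ltW.
set k := Num.bound _ => sdk; exists k.
rewrite ltr_pdivrMr ?exprn_gt0 // (mulrC d) -ltr_pdivrMr //.
by apply: lt_trans sdk _; rewrite -natrX ltr_nat ltn_expl.
Qed.

(** * Bisection of squares *)

Section Cousin.
Variables (R : realType) (P : R -> R -> R -> Prop).

Hypothesis P_merge : forall x y s, 0 < s -> P x y (s / 2) ->
  P (x + s / 2) y (s / 2) -> P x (y + s / 2) (s / 2) ->
  P (x + s / 2) (y + s / 2) (s / 2) -> P x y s.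

Let bad (p : R * R * R) := 0 < p.2 /\ ~ P p.1.1 p.1.2 p.2.

Let sub_square (p q : R * R * R) := [/\ q.2 = p.2 / 2,
  p.1.1 <= q.1.1 <= p.1.1 + p.2 / 2 & p.1.2 <= q.1.2 <= p.1.2 + p.2 / 2].

Let bad_sub p : exists q, bad p -> bad q /\ sub_square p q.
Proof.
(* A square that is not bad is sent to itself; this default value makes the successor a total
   function. *)
have [[s0 nP]|nb] := pselect (bad p); last by exists p.
case: p s0 nP => [[x y] s] /= s0 nP; have s20 : 0 < s / 2 by rewrite divr_gt0.
have [P1|P1] := pselect (P x y (s / 2)); last first.
  by exists (x, y, s / 2) => _; split; split=> //=; lra.
have [P2|P2] := pselect (P (x + s / 2) y (s / 2)); last first.
  by exists (x + s / 2, y, s / 2) => _; split; split=> //=; lra.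
have [P3|P3] := pselect (P x (y + s / 2) (s / 2)); last first.
  by exists (x, y + s / 2, s / 2) => _; split; split=> //=; lra.
have [P4|P4] := pselect (P (x + s / 2) (y + s / 2) (s / 2)); last first.
  by exists (x + s / 2, y + s / 2, s / 2) => _; split; split=> //=; lra.
by case: nP; exact: P_merge.
Qed.

(** If [P] failed, one of the four quarters would be bad, and so on. The nested bad squares have a
    common point, and the local hypothesis at that point contradicts the badness of a sufficiently
    small one. *)
Lemma cousin x y s : 0 < s ->
  (forall x0 y0, x <= x0 <= x + s -> y <= y0 <= y + s ->
     exists2 d, 0 < d & forall x' y' s', 0 < s' < d ->
       x' <= x0 <= x' + s' -> y' <= y0 <= y' + s' -> P x' y' s') ->
  P x y s.
Proof.
move=> s0 Ploc; apply: contrapT => nP.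
have [nxt nxtP] := choice bad_sub.
pose u k := iter k nxt (x, y, s).
have ub k : bad (u k).
  by elim: k => [//|k IH]; have [] := nxtP _ IH.
have us k : sub_square (u k) (u k.+1) by have [] := nxtP _ (ub k).
have u2 k : (u k).2 = s / 2 ^+ k.
  elim: k => [|k IH]; first by rewrite expr0 divr1.
  by have [-> _ _] := us k; rewrite IH exprSr invfM mulrA.
(* For either coordinate [c] of the corner, the lower ends [c (u k)] increase and the upper ends
   decrease; the supremum of the lower ends lies in all the intervals. *)
have nested (c : R * R * R -> R) :
    (forall k, c (u k) <= c (u k.+1) <= c (u k) + (u k).2 / 2) ->
    exists2 c0, forall k, c (u k) <= c0 <= c (u k) + (u k).2 & True.
  move=> cu; have mono k j : c (u k) <= c (u (k + j)%N) /\
      c (u (k + j)%N) + (u (k + j)%N).2 <= c (u k) + (u k).2.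
    elim: j => [|j [IH1 IH2]]; first by rewrite addn0.
    rewrite addnS; have /andP[c1 c2] := cu (k + j)%N.
    have [e _ _] := us (k + j)%N; rewrite e; split; lra.
  have bnd k j : c (u j) <= c (u k) + (u k).2.
    have [kj|jk] := leqP k j.
      have [_] := mono k (j - k)%N; rewrite subnKC //.
      by have [] := ub j; lra.
    have [] := mono j (k - j)%N; rewrite subnKC 1?ltnW // => + _.
    by have [] := ub k; lra.
  exists (sup (range (fun k => c (u k)))) => // k; apply/andP; split.
    apply: ub_le_sup; last by exists k.
    by exists (c (u 0%N) + (u 0%N).2) => _ [j _ <-]; exact: bnd.
  by apply: ge_sup; [exists (c (u k)), k | move=> _ [j _ <-]; exact: bnd].
have [x0 x0P _] := nested (fun p => p.1.1) (fun k => let: And3 _ h _ := us k in h).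
have [y0 y0P _] := nested (fun p => p.1.2) (fun k => let: And3 _ _ h := us k in h).
have [d d0 dP] := Ploc x0 y0 (x0P 0%N) (y0P 0%N).
have [k kd] := exists_div_exp2_lt (ltW s0) d0.
have [u0 uP] := ub k; apply: uP; apply: dP; [by rewrite u0 u2 | exact: x0P | exact: y0P].
Qed.

End Cousin.

(** [L] is an arbitrary function here, so that an estimate can be stated before any linearity or
    continuity of [L] is known. *)
Definition has_diff (K : numFieldType) (V W : normedModType K) (f : V -> W)
    (x : V) (L : V -> W) : Prop :=
  forall e, 0 < e -> exists2 d : K, 0 < d &
    forall w, `|w| < d -> `|f (x + w) - f x - L w| <= e * `|w|.

Definition has_deriv (K : numFieldType) (g : K -> K) (t d : K) : Prop :=
  forall e, 0 < e -> exists2 r : K, 0 < r &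
    forall h, `|h| < r -> `|g (t + h) - g t - d * h| <= e * `|h|.

Lemma differentiable_has_diff (K : numFieldType) (V W : normedModType K)
    (f : V -> W) x : differentiable f x -> has_diff f x ('d f x).
Proof.
move=> df e e0; have /eqaddoP/(_ e e0)/nbhs_normP[d /= d0 dP] := diff_locally df.
exists d => // w wd; have := dP w; rewrite /= sub0r normrN !fctE /= => /(_ wd).
by rewrite opprD addrA (addrC w).
Qed.

Lemma differentiable_has_deriv (K : numFieldType) (g : K^o -> K^o) (t : K) :
  differentiable g t -> has_deriv g t ('d g t 1).
Proof.
move=> /differentiable_has_diff dg e /dg[r r0 rP]; exists r => // h /rP.
have -> : 'd g t 1 * h = 'd g t (h *: (1 : K^o)) by rewrite linearZ mulrC.
by rewrite [_ *: _]mulr1.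
Qed.

(** * Real numbers inside the scalars *)

Section Scalars.
Variables (R : realType) (k : scalar_kind).
Local Notation K := (scalars R k).

(** Nonnegative scalars, in particular norms, are images of reals under this map, which lets one
    argument serve both kinds of scalars. *)
Definition emb : {rmorphism R -> K} :=
  match k return {rmorphism R -> scalars R k} with
  | RealScalars => idfun
  | ComplexScalars => real_complex R
  end.

Lemma ler_emb x y : (emb x <= emb y) = (x <= y).
Proof. by rewrite /emb; case: k => //=; rewrite lecR. Qed.

Lemma ltr_emb x y : (emb x < emb y) = (x < y).
Proof. by rewrite /emb; case: k => //=; rewrite ltcR. Qed.

Lemma ge0_emb (z : K) : 0 <= z -> exists x, z = emb x.
Proof.
rewrite /emb; case: k z => /= z z0; first by exists z.
by exists (complex.Re z); rewrite RRe_real // ger0_real.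
Qed.


Lemma gt0_emb (z : K) : 0 < z -> exists2 x, 0 < x & z = emb x.
Proof.
move=> z0; have [x zE] := ge0_emb (ltW z0); exists x => //.
by rewrite -ltr_emb rmorph0 -zE.
Qed.

Lemma norm_emb x : `|emb x| = emb `|x|.
Proof.
have [x0|x0] := leP 0 x.
  by rewrite !ger0_norm // -(rmorph0 emb) ler_emb.
by rewrite !ltr0_norm ?rmorphN // -(rmorph0 emb) ltr_emb.
Qed.

(** Bisection of the interval, with the second coordinate of the squares as a dummy. The bound
    [(M + e) * s] is additive under halving, and the slack [e] absorbs the error of the first-order
    expansion at a point. *)
Lemma mean_value_ineq (g : K -> K) (M : K) :
  (forall t, 0 <= t <= 1 -> exists2 d, `|d| <= M & has_deriv g (emb t) d) ->
  `|g 1 - g 0| <= M.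
Proof.
move=> gM; apply/ler_addgt0Pr => e e0.
pose P (x y s : R) := `|g (emb (x + s)) - g (emb x)| <= (M + e) * emb s.
suff : P 0 0 1 by rewrite /P add0r rmorph1 rmorph0 mulr1.
apply: (@cousin R P) => //; rewrite /P.
- move=> x y s s0 h1 h2 _ _.
  rewrite (_ : x + s = x + s / 2 + s / 2); last by rewrite -addrA -splitr.
  rewrite -(subrKA (g (emb (x + s / 2)))) (le_trans (ler_normD _ _)) //.
  suff -> : emb s = emb (s / 2) + emb (s / 2) by rewrite mulrDr addrC; exact: lerD.
  by rewrite -rmorphD -splitr.
- move=> x0 y0; rewrite add0r => /gM[d dM dg] _; have [_ /gt0_emb[r r0 ->] rP] := dg e e0.
  have loc h : `|h| < r ->
      `|g (emb (x0 + h)) - g (emb x0)| <= (M + e) * emb `|h|.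
    move=> hr; have := rP (emb h); rewrite norm_emb ltr_emb => /(_ hr) gh.
    rewrite rmorphD -[X in `|X|](subrK (d * emb h)).
    rewrite (le_trans (ler_normD _ _)) // addrC mulrDl lerD // normrM norm_emb.
    by apply: ler_wpM2r => //; rewrite -norm_emb.
  exists r => // x y s /andP[s0 sr] /andP[xx0 x0x] _.
  (* The increment over the interval is split at [x0]; the lengths of the two pieces add up to
     [s]. *)
  have := loc (x + s - x0); have := loc (x - x0).
  rewrite !(addrC x0) !subrK (ger0_norm (x := x + s - x0)); last by lra.
  rewrite (ler0_norm (x := x - x0)); last by lra.
  have -> : - (x - x0) < r by lra.
  have -> : x + s - x0 < r by lra.
  move=> /(_ isT) h1 /(_ isT) h2.
  rewrite -(subrKA (g (emb x0))) (le_trans (ler_normD _ _)) //.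
  have -> : emb s = emb (x + s - x0) + emb (- (x - x0)).
    by rewrite -rmorphD; congr (emb _); lra.
  by rewrite [X in _ + X]distrC mulrDr; exact: lerD.
Qed.

End Scalars.

(** * Goursat's lemma and Cauchy's estimate *)

Section Goursat.
Variable R : realType.
Local Notation C := (R[i]%C).
Implicit Types (G : R -> R -> C) (x y s h : R).

Lemma normc_i : `|'i%C : C| = 1.
Proof. by rewrite normc_def /= expr0n expr1n add0r sqrtr1. Qed.

(* Riemann sum, with N points on each side, for the contour integral of
   G (Re z) (Im z) around the square with lower left corner x + iy and side Nh.
   Opposite sides are sampled at matching points, which makes the sum vanish
   exactly on affine functions. *)
Definition square_sum G x y h N : C :=
  \sum_(j < N) real_complex R h * (G (x + j%:R * h) y - G (x + j%:R * h) (y + N%:R * h)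
    + 'i%C * (G (x + N%:R * h) (y + j%:R * h) - G x (y + j%:R * h))).

(** Each inner edge is sampled at the same points by the two squares that share it, with opposite
    signs, and cancels. *)
Lemma square_sumD G x y h N : square_sum G x y h (N + N) =
  square_sum G x y h N + square_sum G (x + N%:R * h) y h N +
  square_sum G x (y + N%:R * h) h N +
  square_sum G (x + N%:R * h) (y + N%:R * h) h N.
Proof.
rewrite /square_sum big_split_ord /= -!big_split /=; apply: eq_bigr => j _.
rewrite !natrD !mulrDl !addrA.
ring.
Qed.

(** With [2 ^ m] points on each side, the decomposition into four quarters is an exact identity
    ([contourS]) rather than a limit. *)
Definition contour G x y s m : C := square_sum G x y (s / 2 ^+ m) (2 ^ m).

Lemma contourS G x y s m : contour G x y s m.+1 =
  contour G x y (s / 2) m + contour G (x + s / 2) y (s / 2) m +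
  contour G x (y + s / 2) (s / 2) m + contour G (x + s / 2) (y + s / 2) (s / 2) m.
Proof.
have hE : s / 2 ^+ m.+1 = s / 2 / 2 ^+ m by rewrite exprS invfM mulrA.
have NE : (2 ^ m)%:R * (s / 2 / 2 ^+ m) = s / 2.
  by rewrite natrX mulrC divfK // expf_neq0 ?pnatr_eq0.
by rewrite /contour expnS mul2n -addnn square_sumD hE NE.
Qed.

(** The usual bound by perimeter times supremum; all sample points lie on the boundary. *)
Lemma le_contour G x y s m (B : R) : 0 <= s ->
  (forall u v, x <= u <= x + s -> y <= v <= y + s ->
    [\/ u = x, u = x + s, v = y | v = y + s] -> `|G u v| <= real_complex R B) ->
  `|contour G x y s m| <= real_complex R (4 * s * B).
Proof.
move=> s0 GB; rewrite /contour /square_sum.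
have m0 : 0 < 2 ^+ m :> R by rewrite exprn_gt0.
have NE : (2 ^ m)%:R * (s / 2 ^+ m) = s by rewrite natrX mulrC divfK // gt_eqF.
have h0 : 0 <= s / 2 ^+ m by rewrite divr_ge0 // ltW.
move: (s / 2 ^+ m) NE h0 => h NE h0.
rewrite NE (le_trans (ler_norm_sum _ _ _)) //.
have -> : real_complex R (4 * s * B) = \sum_(j < 2 ^ m) real_complex R (h * (4 * B)).
  rewrite sumr_const card_ord -(rmorphMn (real_complex R)); congr (real_complex R _).
  by rewrite -[RHS]mulr_natl (mulrA _ h) NE; ring.
apply: ler_sum => j _.
have jh : 0 <= j%:R * h <= s.
  rewrite mulr_ge0 //= -NE ler_wpM2r // ler_nat; exact: ltnW.
rewrite normrM rmorphM ger0_norm ?ler0c //.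
apply: ler_wpM2l; first by rewrite ler0c.
set b := real_complex R B in GB; rewrite [leRHS](_ : _ = b + b + (b + b)); last first.
  by rewrite -!rmorphD /=; congr (real_complex R _); ring.
rewrite (le_trans (ler_normD _ _)) // normrM normc_i mul1r.
apply: lerD; rewrite (le_trans (ler_normB _ _)) //; apply: lerD; apply: GB; try lra.
- by apply: Or43.
- by apply: Or44.
- by apply: Or42.
- by apply: Or41.
Qed.

Lemma contour_lin G G' (d : C) x y s m :
  contour (fun u v => d * G u v + G' u v) x y s m =
  d * contour G x y s m + contour G' x y s m.
Proof.
rewrite /contour /square_sum mulr_sumr -big_split /=; apply: eq_bigr => j _.
ring.
Qed.

Lemma contour_affine (c d : C) x y s m :
  contour (fun u v => c + d * Complex u v) x y s m = 0.
Proof.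
rewrite /contour /square_sum big1 // => j _.
set h := s / _; set a := _%:R * h; set b := (2 ^ m)%:R * h.
have -> : c + d * Complex (x + a) y - (c + d * Complex (x + a) (y + b)) +
   'i%C * (c + d * Complex (x + b) (y + a) - (c + d * Complex x (y + a))) = 0.
  have -> : Complex (x + a) (y + b) = Complex (x + a) y + 'i%C * Complex b 0.
    by simpc.
  have -> : Complex (x + b) (y + a) = Complex x (y + a) + Complex b 0.
    by simpc.
  ring.
by rewrite mulr0.
Qed.

Lemma normc_le_ReIm (a b : R) : `|Complex a b| <= real_complex R (`|a| + `|b|).
Proof.
have -> : Complex a b = real_complex R a + 'i%C * real_complex R b by simpc.
rewrite (le_trans (ler_normD _ _)) // normrM rmorphD.
by rewrite normc_i mul1r !(@norm_emb R ComplexScalars).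
Qed.

(** This stands in for a bound on the limit of [A], so that the existence of contour integrals is
    never at issue. *)
Definition eventually_le (A : nat -> C) (a : R) :=
  exists m0, forall m, (m0 <= m)%N -> `|A m| <= real_complex R a.

Lemma eventually_leD A B (a b : R) : eventually_le A a -> eventually_le B b ->
  eventually_le (fun m => A m + B m) (a + b).
Proof.
move=> [m1 h1] [m2 h2]; exists (m1 + m2)%N => m mm.
rewrite rmorphD; apply: le_trans (ler_normD _ _) _.
by apply: lerD; [apply: h1 | apply: h2]; lia.
Qed.

(** The bound [e * s ^+ 2] is additive under quartering, so bisection reduces the claim to small
    squares around a point. There the affine part of [g] contributes 0 and the remainder is small
    compared with [s]. *)
Lemma goursat (g : C -> C) x y s (e : R) : 0 < s -> 0 < e ->
  (forall u v, x <= u <= x + s -> y <= v <= y + s ->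
     exists d, has_deriv g (Complex u v) d) ->
  eventually_le (contour (fun u v => g (Complex u v)) x y s) (e * s ^+ 2).
Proof.
move=> s0 e0 gd; pose G u v := g (Complex u v).
pose P x y s := eventually_le (contour G x y s) (e * s ^+ 2).
apply: (@cousin R P) => // [{gd s0 x y s} x y s|x0 y0 x0P y0P].
  move=> s0 [m1 h1] [m2 h2] [m3 h3] [m4 h4].
  exists (m1 + m2 + m3 + m4).+1 => -[//|m] mm; rewrite contourS.
  have -> : e * s ^+ 2 = e * (s / 2) ^+ 2 + e * (s / 2) ^+ 2 + e * (s / 2) ^+ 2 +
      e * (s / 2) ^+ 2.
    by field.
  rewrite !rmorphD.
  apply: (le_trans (ler_normD _ _)); apply: lerD; last by apply: h4; lia.
  apply: (le_trans (ler_normD _ _)); apply: lerD; last by apply: h3; lia.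
  apply: (le_trans (ler_normD _ _)); apply: lerD; [apply: h1 | apply: h2]; lia.
have [d dg] := gd _ _ x0P y0P.
(* A point of the square is within [2 * s] of the centre of expansion, so the remainder is at most
   [e / 8 * (2 * s)]; the perimeter [4 * s] then gives [e * s ^+ 2]. *)
have e8 : 0 < real_complex R (e / 8) by rewrite ltcR divr_gt0.
have [_ /(@gt0_emb R ComplexScalars)[r r0 ->] rP] := dg _ e8.
exists (r / 2); first by rewrite divr_gt0.
move=> {x0P y0P s0 x y s gd} x y s /andP[s0 sr] x0P y0P; exists 0%N => m _.
set z0 := Complex x0 y0 in dg rP.
pose rho u v := G u v - (g z0 - d * z0 + d * Complex u v).
have -> : contour G x y s m = contour rho x y s m.
  rewrite -[RHS]add0r -(mulr1 0) -(contour_affine (g z0 - d * z0) d x y s m).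
  rewrite mulrC -contour_lin; congr contour; apply/funext => u; apply/funext => v.
  by rewrite /rho mul1r addrC subrK.
apply: (@le_trans _ _ (real_complex R (4 * s * (e / 4 * s)))); last first.
  by rewrite lecR (_ : 4 * s * _ = e * s ^+ 2) //; field.
apply: le_contour; first exact: ltW.
move=> u v uP vP _.
have uv : `|Complex (u - x0) (v - y0)| <= real_complex R (2 * s).
  rewrite (le_trans (normc_le_ReIm _ _)) // lecR.
  have : `|u - x0| <= s by rewrite ler_norml; lra.
  have : `|v - y0| <= s by rewrite ler_norml; lra.
  lra.
have /rP : `|Complex (u - x0) (v - y0)| < real_complex R r.
  by rewrite (le_lt_trans uv) // ltcR; lra.
have -> : z0 + Complex (u - x0) (v - y0) = Complex u v.
  by rewrite /z0; simpc; rewrite !(addrC _ (_ - _)) !subrK.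
have -> : g (Complex u v) - g z0 - d * Complex (u - x0) (v - y0) = rho u v.
  have -> : Complex (u - x0) (v - y0) = Complex u v - z0 by rewrite /z0; simpc.
  by rewrite /rho /G; ring.
move=> /le_trans; apply; apply: le_trans (ler_wpM2l (ltW e8) uv) _.
by rewrite -(rmorphM (real_complex R)) lecR; lra.
Qed.

Lemma contour_double G x y s m : contour G x y (s + s) m.+1 =
  contour G x y s m + contour G (x + s) y s m +
  contour G x (y + s) s m + contour G (x + s) (y + s) s m.
Proof. by rewrite contourS (_ : (s + s) / 2 = s) //; field. Qed.

(* The annulus consists of the 12 outer squares of a 4 x 4 grid. *)
Lemma contour_annulus (g : C -> C) c (e : R) : 0 < c -> 0 < e ->
  (forall u v, - c <= u <= c -> - c <= v <= c -> Complex u v != 0 ->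
     exists d, has_deriv g (Complex u v) d) ->
  eventually_le (fun m =>
    contour (fun u v => g (Complex u v)) (- c) (- c) (c + c) m.+1 -
    contour (fun u v => g (Complex u v)) (- (c / 2)) (- (c / 2)) (c / 2 + c / 2) m) e.
Proof.
move=> c0 e0 gd; pose G u v := g (Complex u v).
have sE : c = c / 2 + c / 2 by rewrite -splitr.
move: (c / 2) sE => s cE.
suff : eventually_le (fun m => contour G (- c) (- c) (c + c) m.+1 -
    contour G (- s) (- s) (s + s) m) e by [].
have s0 : 0 < s by lra.
(* [(x, y)] is the lower left corner of a square of the grid. The last condition puts this square in
   an outer column or row, hence away from 0, where [g] need not be differentiable. *)
have small x y : (x = - c \/ x = - s \/ x = 0 \/ x = s) ->
  (y = - c \/ y = - s \/ y = 0 \/ y = s) ->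
  [\/ x = - c, x = s, y = - c | y = s] ->
  eventually_le (contour G x y s) (e / 12).
  move=> xP yP xy; have ep : 0 < e / 12 / s ^+ 2.
    by rewrite divr_gt0 ?exprn_gt0 // divr_gt0.
  have [|m0 m0P] := @goursat g x y s _ s0 ep.
    move=> u v uP vP; apply: gd.
    - by case: xP => [|[|[|]]] xE; rewrite xE in uP; rewrite cE; lra.
    - by case: yP => [|[|[|]]] yE; rewrite yE in vP; rewrite cE; lra.
    rewrite eq_complex /= negb_and; case: xy => E; rewrite E in uP vP *.
    - by rewrite lt_eqF //; lra.
    - by rewrite gt_eqF //; lra.
    - by rewrite orbC lt_eqF //; lra.
    - by rewrite orbC gt_eqF //; lra.
  by exists m0 => m /m0P; rewrite divfK // expf_neq0 // gt_eqF.
pose q x y m := contour G x y s m.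
have ev : eventually_le (fun m => q (- c) (- c) m + q (- s) (- c) m + q 0 (- c) m +
    q s (- c) m + q (- c) (- s) m + q s (- s) m + q (- c) 0 m + q s 0 m +
    q (- c) s m + q (- s) s m + q 0 s m + q s s m)
    (e / 12 + e / 12 + e / 12 + e / 12 + e / 12 + e / 12 + e / 12 + e / 12
      + e / 12 + e / 12 + e / 12 + e / 12).
  do 11 (apply: eventually_leD; last by apply: small; [tauto|tauto|
    (by apply: Or41) || (by apply: Or42) || (by apply: Or43) || (by apply: Or44)]).
  by apply: small; [tauto|tauto|apply: Or41].
have [m0 m0P] := ev; exists m0.+1 => -[//|m] /m0P.
have -> : e / 12 + e / 12 + e / 12 + e / 12 + e / 12 + e / 12 + e / 12 + e / 12
      + e / 12 + e / 12 + e / 12 + e / 12 = e by field.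
congr (`|_| <= _); rewrite cE !contour_double.
have -> : - (s + s) + s = - s by ring.
have -> : - (s + s) + (s + s) = 0 by ring.
have -> : - s + s = 0 by ring.
rewrite !add0r /q -cE; ring.
Qed.
End Goursat.

Lemma differentiable_div_sqr (K : numFieldType) (g : K^o -> K^o) (a z : K^o) :
  differentiable g z -> z != 0 ->
  differentiable (fun z : K^o => (g z - a) * (z ^+ 2)^-1 : K^o) z.
Proof.
move=> dg z0; apply: differentiableM; first exact: differentiableB.
by apply: differentiableV; [exact: (@differentiableM K K^o id id) | rewrite expf_neq0].
Qed.

Section Estimate.
Variable R : realType.
Local Notation C := (R[i]%C).
Implicit Types (G : R -> R -> C) (x y s h : R).

(** The annulus is crossed [k] times, each time halving the square. The exponents [m + k] and [m]
    give the same mesh on the outer and the inner square. *)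
Lemma contour_shrink (g : C -> C) c (e : R) k : 0 < c -> 0 < e ->
  (forall u v, - c <= u <= c -> - c <= v <= c -> Complex u v != 0 ->
     exists d, has_deriv g (Complex u v) d) ->
  eventually_le (fun m =>
    contour (fun u v => g (Complex u v)) (- c) (- c) (c + c) (m + k) -
    contour (fun u v => g (Complex u v)) (- (c / 2 ^+ k)) (- (c / 2 ^+ k))
      (c / 2 ^+ k + c / 2 ^+ k) m) e.
Proof.
move=> c0 e0 gd; elim: k e e0 => [|k IH] e e0.
  by exists 0%N => m _; rewrite expr0 divr1 addn0 subrr normr0 lecR ltW.
have e20 : 0 < e / 2 by rewrite divr_gt0.
have ck0 : 0 < c / 2 ^+ k by rewrite divr_gt0 ?exprn_gt0.
have ckc : c / 2 ^+ k <= c.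
  have k1 : 1 <= 2 ^+ k :> R by rewrite exprn_ege1 // ler1n.
  by rewrite ler_pdivrMr ?exprn_gt0 // ler_peMr // ltW.
have [m1 h1] := IH _ e20.
have [|m2 h2] := @contour_annulus R g (c / 2 ^+ k) (e / 2) ck0 e20.
  by move=> u v uP vP; apply: gd; lra.
exists (m1 + m2)%N => m mm; rewrite exprSr invfM mulrA addnS -addSn.
have := h1 m.+1; have := h2 m.
set A := contour _ _ _ _ _; set B := contour _ _ _ _ _.
set D := contour _ _ _ _ _ => hAB hDA.
rewrite -(subrKA A) (splitr e) rmorphD; apply: le_trans (ler_normD _ _) _.
by apply: lerD; [apply: hDA | apply: hAB]; lia.
Qed.

Lemma normc_ge_Im (z : C) : real_complex R `|complex.Im z| <= `|z|.
Proof.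
have := normc_ge_Re (z * 'i%C); rewrite ReiNIm normrN normrM.
by rewrite normc_i mulr1.
Qed.

(** A discrete trace of the fact that the integral of [1 / z] is [2 i pi]. Only a lower bound for
    the imaginary part is needed, and it holds for every mesh. *)
Lemma contour_inv (c : R) m : 0 < c ->
  4%:R <= `|contour (fun u v : R => ((Complex u v)^-1 : C)) (- c) (- c) (c + c) m|.
Proof.
move=> c0; set I := contour _ _ _ _ _.
suff I4 : 4 <= complex.Im I.
  apply: le_trans (normc_ge_Im I); rewrite -(rmorph_nat (real_complex R)) lecR.
  by rewrite (le_trans I4) // ler_norm.
rewrite /I /contour /square_sum.
have m0 : 0 < 2 ^+ m :> R by rewrite exprn_gt0.
have NE : (2 ^ m)%:R * ((c + c) / 2 ^+ m) = c + c by rewrite natrX mulrC divfK // gt_eqF.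
have h0 : 0 <= (c + c) / 2 ^+ m by rewrite divr_ge0 ?ltW // addr_gt0.
move: ((c + c) / 2 ^+ m) NE h0 => h NE h0; rewrite NE.
rewrite (raddf_sum (@complex.Im R : {additive Rcomplex R -> R})).
(* On the boundary [|z| ^ 2] is at most [2 * c ^+ 2], so each of the four sides contributes at least
   [h / (2 * c)] per sample point. *)
have -> : 4 = \sum_(j < 2 ^ m) (h * (2 / c)).
  by rewrite sumr_const card_ord -[RHS]mulr_natl mulrA NE; field; lra.
apply: ler_sum => j _.
have : 0 <= j%:R * h <= c + c.
  by rewrite mulr_ge0 //= -NE ler_wpM2r // ler_nat; exact: ltnW.
move: (j%:R * h) => a aP.
have -> : - c + (c + c) = c by ring.
simpc => /=; apply: ler_wpM2l => //.
have : (- c + a) ^+ 2 <= c ^+ 2.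
  rewrite -subr_ge0 (_ : _ - _ = a * (c + c - a)); last by ring.
  by apply: mulr_ge0; lra.
rewrite sqrrN (addrC (c ^+ 2)); move: ((- c + a) ^+ 2) (sqr_ge0 (- c + a)) => b b0 bc.
have c20 : 0 < c ^+ 2 by rewrite exprn_gt0.
have D0 : 0 < b + c ^+ 2 by rewrite ltr_wpDl.
have -> : c / (b + c ^+ 2) + c / (b + c ^+ 2) + (c / (b + c ^+ 2) + c / (b + c ^+ 2)) =
  4 * c / (b + c ^+ 2) by field; rewrite gt_eqF.
rewrite ler_pdivlMr // mulrAC ler_pdivrMr //; nra.
Qed.

(** The contour of [(g z - g 0) / z ^+ 2] is compared on two squares. On the outer one it is at most
    [8 * r] times [2 * M / r ^+ 2]; on a tiny one the integrand is close to [d / z], whose contour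
    has norm at least [4 * |d|]. *)
Lemma cauchy_estimate (g : C^o -> C^o) (r M : R) : 0 < r ->
  (forall u v : R, - r <= u <= r -> - r <= v <= r ->
    differentiable g (Complex u v : C^o) /\ `|g (Complex u v)| <= real_complex R M) ->
  `|'d g 0 1| <= real_complex R (4 * M / r).
Proof.
move=> r0 gP; set d := 'd g 0 1.
have rr : - r <= 0 <= r by lra.
have [dg00 g0M] := gP 0 0 rr rr.
have M0 : 0 <= M by rewrite -ler0c; apply: le_trans g0M.
pose G (z : C^o) : C^o := (g z - g 0) * (z ^+ 2)^-1.
have dG (u v : R) : - r <= u <= r -> - r <= v <= r -> Complex u v != 0 ->
    exists d, has_deriv G (Complex u v) d.
  move=> uP vP z0; have [dg _] := gP u v uP vP.
  exists ('d G (Complex u v : C^o) 1); apply: differentiable_has_deriv.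
  exact: differentiable_div_sqr.
have dg0 : has_deriv g 0 d.
  by apply: differentiable_has_deriv; exact: dg00.
have bdry (c u v : R) : 0 < c -> - c <= u <= - c + (c + c) -> - c <= v <= - c + (c + c) ->
    [\/ u = - c, u = - c + (c + c), v = - c | v = - c + (c + c)] ->
    real_complex R c <= `|Complex u v|.
  move=> c0 _ _; have -> : - c + (c + c) = c by ring.
  have hu : `|u| = c -> real_complex R c <= `|Complex u v|.
    by move=> <-; exact: (normc_ge_Re (Complex u v)).
  have hv : `|v| = c -> real_complex R c <= `|Complex u v|.
    by move=> <-; exact: (normc_ge_Im (Complex u v)).
  by case=> E; [apply: hu|apply: hu|apply: hv|apply: hv]; rewrite E ?normrN gtr0_norm.
suff : 4%:R * `|d| <= real_complex R (16 * M / r).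
  move=> h; rewrite -(ler_pM2l (x := 4%:R)) ?ltr0n // (le_trans h) //.
  by rewrite -(rmorph_nat (real_complex R)) -rmorphM lecR; lra.
apply/ler_addgt0Pr => _ /(@gt0_emb R ComplexScalars)[e e0 ->].
(* Shrinking the square costs [e / 9]. Replacing [G] by [d / z] costs [e / 9 / c] pointwise, hence
   [8 * e / 9] over the perimeter [8 * c]. The total is [e]. *)
have e90 : 0 < e / 9 by rewrite divr_gt0.
have [|_ /(@gt0_emb R ComplexScalars)[rho rho0 ->] rhoP] := dg0 (real_complex R (e / 9)).
  by rewrite ltcR.
have r20 : 0 <= 2 * r by rewrite mulr_ge0 // ltW.
have [k kP] := exists_div_exp2_lt r20 rho0.
have [m0 /(_ m0 (leqnn _)) hm] := contour_shrink k r0 e90 dG.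
set c := r / 2 ^+ k in hm.
have c0 : 0 < c by rewrite divr_gt0 ?exprn_gt0.
have ck : c + c < rho by rewrite /c; lra.
set A := contour _ _ _ _ _ in hm; set B := contour _ _ _ _ _ in hm.
have hA : `|A| <= real_complex R (16 * M / r).
  rewrite (_ : 16 * M / r = 4 * (r + r) * (2 * M / r ^+ 2)); last by field; lra.
  apply: le_contour; first lra.
  move=> {}u {}v uP vP uv; have zr := bdry _ _ _ r0 uP vP uv.
  have zr0 : 0 < `|Complex u v| by apply: lt_le_trans zr; rewrite ltcR.
  rewrite normrM normfV normrX rmorphM fmorphV rmorphXn /=; apply: ler_pM => //.
  - apply: le_trans (ler_normB _ _) _; rewrite mulr_natl rmorphMn mulr2n /=.
    have [||_ gu] := gP u v; [lra|lra|exact: lerD].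
  - have rC0 : 0 < real_complex R r by rewrite ltcR.
    rewrite lef_pV2 ?posrE ?exprn_gt0 //.
    by rewrite lerXn2r // ?nnegrE ?ltW.
pose T := contour (fun u v : R => ((Complex u v)^-1 : C)) (- c) (- c) (c + c) m0.
pose Q := contour (fun u v : R => G (Complex u v) - d * (Complex u v)^-1)
  (- c) (- c) (c + c) m0.
have BE : B = d * T + Q.
  rewrite -contour_lin /B; congr contour; apply/funext => ?; apply/funext => ?.
  by rewrite addrC subrK.
have hQ : `|Q| <= real_complex R (8 * e / 9).
  rewrite (_ : 8 * e / 9 = 4 * (c + c) * (e / 9 / c)); last by field; lra.
  apply: le_contour; first lra.
  move=> a b uP vP uv; have zc := bdry _ _ _ c0 uP vP uv.
  set z := Complex a b in zc *.
  have zc0 : 0 < `|z| by apply: lt_le_trans zc; rewrite ltcR.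
  have z0 : z != 0 by rewrite -normr_gt0.
  have zrho : `|z| < real_complex R rho.
    apply: le_lt_trans (normc_le_ReIm a b) _; rewrite ltcR.
    have hu : `|a| <= c by rewrite ler_norml; lra.
    have hv : `|b| <= c by rewrite ler_norml; lra.
    lra.
  have := rhoP z zrho; rewrite add0r => hz.
  have -> : G z - d * z^-1 = (g z - g 0 - d * z) * (z ^+ 2)^-1.
    by rewrite /G; field.
  rewrite normrM normfV normrX ler_pdivrMr ?exprn_gt0 //; apply: le_trans hz _.
  have cC0 : 0 < real_complex R c by rewrite ltcR.
  have e9C : 0 < real_complex R (e / 9) by rewrite ltcR.
  have -> : real_complex R (e / 9 / c) = real_complex R (e / 9) / real_complex R c.
    by rewrite -fmorphV -rmorphM.
  rewrite expr2 mulrA ler_pM2r // -mulrA ler_peMr ?(ltW e9C) //.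
  by rewrite mulrC ler_pdivlMr ?mul1r.
have hT : 4%:R * `|d| <= `|d * T|.
  by rewrite normrM mulrC ler_wpM2l //; exact: contour_inv.
apply: le_trans hT _; have -> : d * T = A - (A - B) - Q by rewrite BE; ring.
have -> : real_complex R (16 * M / r) + emb R ComplexScalars e =
   real_complex R (16 * M / r) + real_complex R (e / 9) + real_complex R (8 * e / 9).
  rewrite -addrA; congr (_ + _); rewrite -(rmorphD (real_complex R)) /=.
  by congr (real_complex R _); field.
apply: le_trans (ler_normB _ _) _; apply: lerD => //.
by apply: le_trans (ler_normB _ _) _; apply: lerD.
Qed.
End Estimate.

(** * Derivatives of holomorphic functions *)

Section Differentials.
Variable K : numFieldType.

Lemma differentiable_line (V W : normedModType K) (f : V -> W) y v (t : K^o) :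
  differentiable f (y + t *: v) ->
  differentiable (fun z : K^o => f (y + z *: v)) t /\
  'd (fun z : K^o => f (y + z *: v)) t 1 = 'd f (y + t *: v) v.
Proof.
move=> df; pose l (z : K^o) := y + z *: v.
have dl : is_diff t l (fun h => h *: v).
  apply: is_diff_eq; rewrite /l.
  by rewrite add0r.
have dfl : differentiable f (l t) by [].
split; first exact: (@differentiable_comp _ _ _ _ l f).
by rewrite (@diff_comp _ _ _ _ l f) //= diff_val scale1r.
Qed.

Lemma differentiable_shift (V W : normedModType K) (f : V -> W) y w :
  differentiable f (y + w) ->
  differentiable (fun z => f (z + w)) y /\
  'd (fun z => f (z + w)) y = 'd f (y + w) :> (V -> W).
Proof.
move=> df; pose l (z : V) := z + w.
have dl : is_diff y l id.
  apply: is_diff_eq; rewrite /l.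
  by rewrite addr0.
have dfl : differentiable f (l y) by [].
split; first exact: (@differentiable_comp _ _ _ _ l f).
by rewrite (@diff_comp _ _ _ _ l f) //= diff_val.
Qed.

Lemma diffB_val (V W : normedModType K) (f g : V -> W) x v :
  differentiable f x -> differentiable g x ->
  'd (f - g) x v = 'd f x v - 'd g x v.
Proof. by move=> df dg; rewrite diffB. Qed.

Lemma diffZ_val (V W : normedModType K) (f : V -> W) (c : K) x v :
  differentiable f x -> 'd (c *: f) x v = c *: 'd f x v.
Proof. by move=> df; rewrite diffZ. Qed.

Lemma has_diff0_differentiable (V W : normedModType K) (f : V -> W) x :
  has_diff f x (fun=> 0) -> differentiable f x.
Proof.
move=> hd.
have fE : f \o shift x = cst (f x) + (\0 : V -> W) +o_ 0 id.
  apply/eqaddoP => e /hd[d d0 dP].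
  apply/nbhs_normP; exists d => // w /=; rewrite sub0r normrN => /dP.
  by rewrite !fctE /= subr0 addr0 (addrC w).
have df : 'd f x = (\0 : V -> W) :> (V -> W).
  by apply: diff_unique => // z; exact: cvg_cst.
by apply/diff_locallyP; rewrite df; split=> // z; exact: cvg_cst.
Qed.

End Differentials.

(** Such properties of the scalars let later arguments treat both kinds at once: this one is proved
    for both, [cauchy_property] for complex scalars. The order on [K] forces [t] to be real. *)
Definition mean_value_property (K : numFieldType) : Prop :=
  forall (V : normedModType K) (f : V -> K^o) (y w : V) (c M : K),
  (forall t : K, 0 <= t <= 1 -> differentiable f (y + t *: w) /\
    `|'d f (y + t *: w) w - c| <= M) ->
  `|f (y + w) - f y - c| <= M.

Definition cauchy_property (K : numFieldType) : Prop :=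
  forall (V : normedModType K) (f : V -> K^o) (y : V) (rho M : K), 0 < rho ->
  (forall w, `|w| < rho -> differentiable f (y + w) /\ `|f (y + w)| <= M) ->
  forall v, `|'d f y v| <= 16%:R * M / rho * `|v|.

Section Segment.
Variables (R : realType) (k : scalar_kind).
Local Notation K := (scalars R k).

Lemma mean_value_segment : mean_value_property K.
Proof.
move=> V f y w c M fM; pose g (z : K) := f (y + z *: w) - c * z.
have -> : f (y + w) - f y - c = g 1 - g 0.
  by rewrite /g scale1r scale0r addr0 mulr1 mulr0 subr0 addrAC.
apply: mean_value_ineq => t /andP[t0 t1].
have /fM[df dM] : 0 <= emb R k t <= 1.
  by rewrite -(rmorph0 (emb R k)) -(rmorph1 (emb R k)) !ler_emb t0.
exists ('d f (y + emb R k t *: w) w - c) => // e e0.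
have [dl dlE] := differentiable_line df.
have [r r0 rP] := differentiable_has_deriv dl e0; exists r => // h /rP.
rewrite dlE; congr (`|_| <= _); rewrite /g; ring.
Qed.

End Segment.

Section Holomorphic.
Variable R : realType.
Local Notation C := (R[i]%C).
Implicit Types V : normedModType C.

Lemma gt0_realC (z : C) : 0 < z -> exists2 x, 0 < x & z = real_complex R x.
Proof. exact: (@gt0_emb R ComplexScalars). Qed.

Lemma ge0_realC (z : C) : 0 <= z -> exists x, z = real_complex R x.
Proof. exact: (@ge0_emb R ComplexScalars). Qed.

Lemma diff_bound : cauchy_property C.
Proof.
move=> V f y rho M /gt0_realC[r r0 ->] fP v.
have [->|v0] := eqVneq v 0; first by rewrite linear0 !normr0 mulr0.
have [w w0 wE] : exists2 w, 0 < w & `|v| = real_complex R w.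
  by apply: gt0_realC; rewrite normr_gt0.
have [M' ME] : exists M', M = real_complex R M'.
  apply: ge0_realC; have [|_] := fP 0; first by rewrite normr0 ltcR.
  exact: le_trans.
(* For [z] in the square of half side [t], [|z| <= 2 * t] keeps [z *: v] inside the ball of radius
   [r]; then [4 * M / t] is the announced [16 * M / r * |v|]. *)
pose t := r / (4 * w).
have t0 : 0 < t by rewrite divr_gt0 // mulr_gt0.
have small (z : C) : `|z| <= real_complex R (2 * t) -> `|z *: v| < real_complex R r.
  move=> zt; rewrite normrZ wE /=; apply: le_lt_trans (ler_wpM2r _ zt) _.
    by rewrite lecR ltW.
  rewrite -(rmorphM (real_complex R)) ltcR /t.
  have -> : 2 * (r / (4 * w)) * w = r / 2 by field; lra.
  lra.
have dv0 : differentiable f (y + (0 : C^o) *: v).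
  by have [] := fP (0 *: v); rewrite // scale0r normr0 ltcR.
have [_] := differentiable_line dv0; rewrite scale0r addr0 => <-.
have -> : 16%:R * M / real_complex R r * `|v| = real_complex R (4 * M' / t).
  rewrite ME wE /= -(rmorph_nat (real_complex R)) -(fmorphV (real_complex R)).
  rewrite -!(rmorphM (real_complex R)).
  by congr (real_complex R _); rewrite /t; field; lra.
apply: cauchy_estimate => // a b aP bP.
have [|df fM] := fP (Complex a b *: v).
  apply: small; apply: le_trans (normc_le_ReIm _ _) _; rewrite lecR.
  have ha : `|a| <= t by rewrite ler_norml.
  have hb : `|b| <= t by rewrite ler_norml.
  lra.
split; first by have [] := differentiable_line (t := (Complex a b : C^o)) df.
by apply: le_trans fM _; rewrite ME.
Qed.

End Holomorphic.

Section Norms.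
Variable K : numFieldType.

Lemma normD_lt (V : normedZmodType K) (u w : V) (a b : K) :
  `|u| < a -> `|w| < b -> `|u + w| < a + b.
Proof. by move=> ua wb; apply: le_lt_trans (ler_normD _ _) (ltrD ua wb). Qed.

Lemma gt0_below (a b : K) : 0 < a -> 0 < b -> exists2 c, 0 < c & c <= a /\ c <= b.
Proof.
move=> a0 b0; have ab0 : 0 < a + b by rewrite addr_gt0.
exists (a * b / (a + b)); first by rewrite divr_gt0 // mulr_gt0.
rewrite !ler_pdivrMr //; split; first by rewrite ler_pM2l // lerDr ltW.
by rewrite mulrC ler_pM2l // lerDl ltW.
Qed.

Lemma norm_coord_le n (w : 'rV[K]_n) a : `|w 0 a| <= `|w|.
Proof.
have : (`|w 0 a|%:nng <= \big[Order.max/0%:nng]_i `|w i.1 i.2|%:nng)%R.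
  exact: (le_bigmax _ (fun i => `|w i.1 i.2|%:nng) (0, a)).
by rewrite -num_le.
Qed.

Lemma norm_delta_le n (a : 'I_n) : `|delta_mx 0 a : 'rV[K]_n| <= 1.
Proof.
rewrite [leLHS]/Num.Def.normr /=.
have [->//|/mx_norm_neq0[i ->]] := eqVneq (mx_norm (delta_mx 0 a : 'rV[K]_n)) 0.
by rewrite mxE; case: (_ && _); rewrite ?normr1 ?normr0.
Qed.

End Norms.

(** * Second differences *)

Section SecondOrder.
Variable C : numFieldType.
Hypothesis mean_value : mean_value_property C.
Hypothesis diff_bound : cauchy_property C.

(* H is almost linear because its second differences are the derivatives of
   second differences of f, which are quadratically small. *)
Lemma second_order (V : normedModType C) (f : V -> C^o) x0 (d M : C) : 0 < d ->
  (forall u, `|u| < d *+ 5 -> differentiable f (x0 + u) /\ `|f (x0 + u)| <= M) ->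
  exists2 A : C, 0 <= A & forall v : V,
    let H w := 'd f (x0 + w) v - 'd f x0 v in
    (forall w w', `|w| < d / 2 -> `|w'| < d / 2 ->
      `|H (w + w') - H w - H w'| <= A * `|v| * (`|w| + `|w'|) ^+ 2) /\
    (forall (c : C) w, `|c| <= 1 -> `|w| < d / 2 ->
      `|H (c *: w) - c * H w| <= A * `|v| * (`|c| * `|w| ^+ 2)).
Proof.
move=> d0 fP.
have dS m : (m <= 5)%N -> forall u : V, `|u| < d *+ m -> `|u| < d *+ 5.
  by move=> m5 u um; apply: lt_le_trans um _; rewrite ler_pMn2l.
have df u : `|u| < d *+ 5 -> differentiable f (x0 + u) by move=> /fP[].
have M0 : 0 <= M.
  by have [|_] := fP 0; [rewrite normr0 mulrn_wgt0 | exact: le_trans].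
have [L L0 LE] : exists2 L, 0 <= L & L = 16%:R * M / d.
  by eexists; last reflexivity; rewrite divr_ge0 ?mulr_ge0 // ltW.
(* [S1] bounds the derivative, [S2] deduces a Lipschitz bound, [S3] applies Cauchy's estimate to a
   first difference and makes the derivative Lipschitz, and [S4] is the resulting quadratic
   remainder. The domains shrink by multiples of [d] on the way. *)
have S1 u v : `|u| < d *+ 4 -> `|'d f (x0 + u) v| <= L * `|v|.
  move=> u4; rewrite LE; apply: diff_bound => // w wd; rewrite -addrA; apply: fP.
  by rewrite mulrSr; exact: normD_lt.
have tle (t : C) (w : V) : 0 <= t <= 1 -> `|t *: w| <= `|w|.
  by move=> /andP[t0 t1]; rewrite normrZ ler_piMl // ger0_norm.
have S2 u w : `|u| < d *+ 3 -> `|w| < d -> `|f (x0 + u + w) - f (x0 + u)| <= L * `|w|.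
  move=> u3 wd; rewrite -[X in `|X|]subr0.
  apply: mean_value => t t01.
  have ut : `|u + t *: w| < d *+ 4.
    by rewrite mulrSr; apply: normD_lt => //; apply: le_lt_trans (tle _ _ t01) wd.
  rewrite -addrA subr0; split; last exact: S1.
  by apply: df; apply: dS ut.
have S3 u w v : `|u| < d *+ 2 -> `|w| < d ->
    `|'d f (x0 + u + w) v - 'd f (x0 + u) v| <= 16%:R * (L * `|w|) / d * `|v|.
  move=> u2 wd.
  have dfu : differentiable f (x0 + u) by apply: df; apply: dS u2.
  have dfw : differentiable f (x0 + u + w).
    rewrite -addrA; apply: df; apply: (@dS 3%N) => //.
    by rewrite mulrSr; exact: normD_lt.
  have [ds dsE] := differentiable_shift dfw.
  have <- : 'd ((fun z => f (z + w)) - f) (x0 + u) v =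
      'd f (x0 + u + w) v - 'd f (x0 + u) v.
    by rewrite (diffB_val _ ds dfu) dsE.
  apply: diff_bound => // w' w'd.
  have u3 : `|u + w'| < d *+ 3 by rewrite mulrSr; exact: normD_lt.
  rewrite -addrA; split; last by rewrite !fctE; exact: S2.
  apply: differentiableB; last by apply: df; apply: dS u3.
  apply: (differentiable_shift _).1; rewrite -addrA; apply: df; apply: (@dS 4%N) => //.
  by rewrite mulrSr; exact: normD_lt.
have [L2 L20 L2E] : exists2 L2, 0 <= L2 & L2 = 16%:R * L / d.
  by eexists; last reflexivity; rewrite divr_ge0 ?mulr_ge0 // ltW.
have S4 u w : `|u| < d *+ 2 -> `|w| < d ->
    `|f (x0 + u + w) - f (x0 + u) - 'd f (x0 + u) w| <= L2 * `|w| ^+ 2.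
  move=> u2 wd; apply: mean_value => t t01.
  have twd := le_lt_trans (tle _ w t01) wd.
  split.
    rewrite -addrA; apply: df; apply: (@dS 3%N) => //.
    by rewrite mulrSr; exact: normD_lt.
  apply: le_trans (S3 _ _ _ u2 twd) _.
  rewrite expr2 [leRHS]mulrA ler_wpM2r //.
  rewrite (_ : 16%:R * _ / d = L2 * `|t *: w|); last by rewrite L2E; ring.
  exact: ler_wpM2l (tle _ _ t01).
have d2 : d / 2 <= d by rewrite ler_pdivrMr ?ltr0n // ler_pMr // ler1n.
exists (16%:R * (L2 *+ 2) / d).
  by rewrite divr_ge0 ?mulr_ge0 ?mulrn_wge0 // ltW.
pose fs w (z : V) := f (z + w).
have dfs w u : `|u| < d -> `|w| < d *+ 2 -> differentiable (fs w) (x0 + u).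
  move=> ud wd; apply: (differentiable_shift _).1; rewrite -addrA; apply: df.
  by apply: (@dS 3%N) => //; rewrite mulrS; exact: normD_lt.
have dfs0 w v : `|w| < d *+ 2 -> 'd (fs w) x0 v = 'd f (x0 + w) v.
  move=> wd; apply: (congr1 (@^~ v)); apply: (differentiable_shift _).2.
  by apply: df; apply: dS wd.
have d1 : d <= d *+ 2 by rewrite mulr2n lerDl ltW.
have d02 : `|0 : V| < d *+ 2 by rewrite normr0 mulrn_wgt0.
have u2 (u : V) : `|u| < d -> `|u| < d *+ 2 by move=> /lt_le_trans; apply.
have dx0 w : `|w| < d *+ 2 -> differentiable (fs w) x0.
  by move=> wd; rewrite -(addr0 x0); apply: dfs => //; rewrite normr0.
move=> v H; split.
  move=> w w' wd w'd.
  have wwd : `|w + w'| < d by rewrite (splitr d); exact: normD_lt.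
  have wd' := lt_le_trans wd d2; have w'd' := lt_le_trans w'd d2.
  have -> : H (w + w') - H w - H w' = 'd (fs (w + w') - fs w - (fs w' - fs 0)) x0 v.
    have [e1 e2 e3] : [/\ differentiable (fs (w + w')) x0, differentiable (fs w) x0
        & differentiable (fs w') x0] by split; apply: dx0; exact: u2.
    have e0 := dx0 0 d02.
    rewrite (diffB_val v (differentiableB e1 e2) (differentiableB e3 e0)).
    rewrite (diffB_val v e1 e2) (diffB_val v e3 e0) (dfs0 _ _ (u2 _ wwd)).
    rewrite (dfs0 _ _ (u2 _ wd')) (dfs0 _ _ (u2 _ w'd')) (dfs0 _ _ d02) addr0 /H.
    ring.
  rewrite (_ : 16%:R * _ / d * _ * _ =
    16%:R * ((L2 *+ 2) * (`|w| + `|w'|) ^+ 2) / d * `|v|); last by ring.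
  apply: diff_bound => // u ud; split.
    by do ?[apply: differentiableB]; apply: dfs => //; exact: u2.
  rewrite !fctE /fs addr0.
  (* The linear parts cancel in the second difference, which leaves three remainders of the kind
     bounded by [S4]. *)
  have -> : f (x0 + u + (w + w')) - f (x0 + u + w) - (f (x0 + u + w') - f (x0 + u)) =
     (f (x0 + u + (w + w')) - f (x0 + u) - 'd f (x0 + u) (w + w')) -
     (f (x0 + u + w) - f (x0 + u) - 'd f (x0 + u) w) -
     (f (x0 + u + w') - f (x0 + u) - 'd f (x0 + u) w').
    have e (a b c z p q : C) :
      a - b - (c - z) = a - z - (p + q) - (b - z - p) - (c - z - q) by ring.
    rewrite (linearD ('d f (x0 + u))); exact: e.
  apply: le_trans (ler_normB _ _) _.
  apply: (@le_trans _ _ (L2 * (`|w| + `|w'|) ^+ 2 + L2 * `|w| ^+ 2 + L2 * `|w'| ^+ 2)).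
    apply: lerD; last by apply: S4 => //; exact: u2.
    apply: le_trans (ler_normB _ _) _; apply: lerD; last by apply: S4 => //; exact: u2.
    apply: le_trans (S4 _ _ (u2 _ ud) wwd) _.
    rewrite ler_wpM2l // lerXn2r ?nnegrE ?addr_ge0 //.
    exact: ler_normD.
  rewrite -!mulrDr mulrnAl -mulrnAr ler_wpM2l // mulr2n -addrA lerD2l sqrrD.
  by rewrite [leRHS]addrAC lerDl mulrn_wge0 // mulr_ge0.
move=> c w c1 wd.
have wd' := lt_le_trans wd d2.
have cw : `|c *: w| <= `|w| by rewrite normrZ ler_piMl.
have cwd := le_lt_trans cw wd'.
have -> : H (c *: w) - c * H w = 'd (fs (c *: w) - fs 0 - c *: (fs w - fs 0)) x0 v.
  have [e1 e2 e0] : [/\ differentiable (fs (c *: w)) x0, differentiable (fs w) x0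
      & differentiable (fs 0) x0] by split; apply: dx0 => //; exact: u2.
  rewrite (diffB_val v (differentiableB e1 e0) (differentiableZ c (differentiableB e2 e0))).
  rewrite (diffZ_val c v (differentiableB e2 e0)).
  rewrite (diffB_val v e1 e0) (diffB_val v e2 e0) (dfs0 _ _ (u2 _ cwd)).
  by rewrite (dfs0 _ _ (u2 _ wd')) (dfs0 _ _ d02) addr0.
rewrite (_ : 16%:R * _ / d * _ * _ =
    16%:R * ((L2 *+ 2) * (`|c| * `|w| ^+ 2)) / d * `|v|); last by ring.
apply: diff_bound => // u ud; split.
  apply: differentiableB; do ?[apply: differentiableZ];
    by apply: differentiableB; apply: dfs => //; exact: u2.
rewrite !fctE /fs addr0.
have -> : f (x0 + u + c *: w) - f (x0 + u) - c *: (f (x0 + u + w) - f (x0 + u)) =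
   (f (x0 + u + c *: w) - f (x0 + u) - 'd f (x0 + u) (c *: w)) -
   c * (f (x0 + u + w) - f (x0 + u) - 'd f (x0 + u) w).
  have e (a b z p : C) : a - z - c * (b - z) = a - z - c * p - c * (b - z - p) by ring.
  have -> : 'd f (x0 + u) (c *: w) = c *: 'd f (x0 + u) w by rewrite linearZ.
  exact: e.
apply: le_trans (ler_normB _ _) _; rewrite mulrnAl mulr2n; apply: lerD.
  apply: le_trans (S4 _ _ (u2 _ ud) cwd) _; rewrite ler_wpM2l // normrZ exprMn.
  by rewrite ler_wpM2r ?exprn_ge0 // expr2 ler_piMl.
by rewrite normrM mulrCA ler_wpM2l //; apply: S4 => //; exact: u2.
Qed.
End SecondOrder.

(** A stability property: additivity and homogeneity up to quadratic errors force closeness to an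
    honest linear form. The factor [n.+1] keeps all partial sums of the coordinate vectors of [w] in
    the ball of radius [d]. *)
Definition almost_linear_property (K : numFieldType) : Prop :=
  forall n (H : 'rV[K]_n -> K) (d A : K), 0 < d -> 0 <= A ->
  (forall w w', `|w| < d -> `|w'| < d ->
    `|H (w + w') - H w - H w'| <= A * (`|w| + `|w'|) ^+ 2) ->
  (forall c w, `|c| <= 1 -> `|w| < d ->
    `|H (c *: w) - c * H w| <= A * (`|c| * `|w| ^+ 2)) ->
  exists a : 'I_n -> K, exists2 B, 0 <= B & forall w, `|w| *+ n.+1 < d ->
    `|H w - \sum_i w 0 i * a i| <= B * `|w| ^+ 2.

(** * Almost linear functions *)

Section HolomorphicDerivative.
Variable R : realType.
Local Notation C := (R[i]%C).

(** Helly's theorem on the line; the supremum of the left ends is a common point. *)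
Lemma intervals_common_point (I : Type) (i0 : I) (c rho : I -> R) :
  (forall i j, `|c i - c j| <= rho i + rho j) ->
  exists x, forall i, `|c i - x| <= rho i.
Proof.
move=> meet; exists (sup (range (fun i => c i - rho i))) => i.
have cc j : c j - rho j <= c i + rho i.
  by have := meet j i; rewrite ler_norml; lra.
have h1 : c i - rho i <= sup (range (fun i => c i - rho i)).
  apply: ub_le_sup; last by exists i.
  by exists (c i + rho i) => _ [j _ <-]; exact: cc.
have h2 : sup (range (fun i => c i - rho i)) <= c i + rho i.
  by apply: ge_sup; [exists (c i - rho i), i | move=> _ [j _ <-]; exact: cc].
rewrite ler_norml; lra.
Qed.

(** Discs that meet pairwise may have no common point, but their projections to the two axes do.
    Adding the two coordinate errors accounts for the doubled radii. The lemma produces limits of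
    difference quotients without sequences. *)
Lemma discs_common_point (I : Type) (i0 : I) (c : I -> C) (rho : I -> R) :
  (forall i j, `|c i - c j| <= real_complex R (rho i + rho j)) ->
  exists x, forall i, `|c i - x| <= real_complex R (2 * rho i).
Proof.
move=> meet.
have [|x xP] := @intervals_common_point I i0 (fun i => complex.Re (c i)) rho.
  move=> i j; rewrite -lecR; apply: le_trans (meet i j).
  rewrite -[X in `|X|](raddfB (@complex.Re R : {additive Rcomplex R -> R})).
  exact: normc_ge_Re.
have [|y yP] := @intervals_common_point I i0 (fun i => complex.Im (c i)) rho.
  move=> i j; rewrite -lecR; apply: le_trans (meet i j).
  rewrite -[X in `|X|](raddfB (@complex.Im R : {additive Rcomplex R -> R})).
  exact: normc_ge_Im.
exists (Complex x y) => i.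
have -> : c i - Complex x y = Complex (complex.Re (c i) - x) (complex.Im (c i) - y).
  by case: (c i) => a b; simpc.
apply: le_trans (normc_le_ReIm _ _) _; rewrite lecR.
by have := xP i; have := yP i; lra.
Qed.

Lemma almost_linear : almost_linear_property C.
Proof.
move=> n H d A d0 A0 HD HZ.
have [a' A0' AE] : exists2 A', 0 <= A' & A = real_complex R A'.
  by have [A' AE] := ge0_realC A0; exists A' => //; rewrite -ler0c -AE.
have [d' d0' dE] := gt0_realC d0.
have H0 : H 0 = 0.
  have := HZ 0 0; rewrite !normr0 scale0r !mul0r mulr0 subr0 => /(_ ler01 d0).
  by rewrite normr_le0 => /eqP.
have ray i : exists a : C, forall z : C, `|z| < d ->
    `|H (z *: delta_mx 0 i) - z * a| <= 3%:R * A * `|z| ^+ 2.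
  pose e : 'rV[C]_n := delta_mx 0 i.
  have ze (z : C) : `|z *: e| <= `|z| by rewrite normrZ ler_piMr // norm_delta_le.
  pose q (t : R) := H (real_complex R t *: e) / real_complex R t.
  have qq s t : 0 < s -> s <= t -> t < d' -> `|q s - q t| <= real_complex R (a' * t).
    move=> s0 st td; have t0 : 0 < t by apply: lt_le_trans st.
    have sC : 0 < real_complex R s by rewrite ltcR.
    have tC : 0 < real_complex R t by rewrite ltcR.
    pose c := real_complex R (s / t).
    have c0 : `|c| = real_complex R (s / t).
      by rewrite ger0_norm // ler0c divr_ge0 // ltW.
    have tE : `|real_complex R t| = real_complex R t by rewrite gtr0_norm.
    have := HZ c (real_complex R t *: e).
    rewrite c0 -(rmorph1 (real_complex R)) lecR ler_pdivrMr ?mul1r // st.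
    have -> : `|real_complex R t *: e| < d.
      by apply: le_lt_trans (ze _) _; rewrite tE dE ltcR.
    move=> /(_ isT isT); rewrite scalerA.
    have -> : c * real_complex R t = real_complex R s.
      by rewrite -(rmorphM (real_complex R)) divfK // gt_eqF.
    have -> : q s - q t =
        (H (real_complex R s *: e) - c * H (real_complex R t *: e)) / real_complex R s.
      rewrite /q mulrBl /c (rmorphM (real_complex R)) fmorphV /=; congr (_ - _).
      by field; rewrite ?gt_eqF.
    move=> h; rewrite normrM normfV (gtr0_norm sC) ler_pdivrMr //.
    apply: le_trans h _; rewrite AE.
    apply: (@le_trans _ _
      (real_complex R a' * (real_complex R (s / t) * real_complex R t ^+ 2))).
      have stC : 0 <= real_complex R (s / t) by rewrite -c0.
      rewrite ler_wpM2l // ?ler0c // ler_wpM2l //.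
      by rewrite lerXn2r ?nnegrE // -?[leRHS]tE // ltW.
    rewrite -rmorphXn -!(rmorphM (real_complex R)) lecR.
    by rewrite (_ : a' * (s / t * _) = a' * t * s) //; field; rewrite gt_eqF.
  (* The quotients q t with 0 < t < d' lie in pairwise intersecting discs. *)
  pose I := {t : R | 0 < t < d'}.
  have i0 : I by exists (d' / 2); lra.
  have [|a aP] := @discs_common_point I i0 (fun t => q (val t)) (fun t => a' * val t).
    move=> [s /= /andP[s0 sd]] [t /= /andP[t0 td]]; have [st|/ltW ts] := leP s t.
      apply: le_trans (qq _ _ s0 st td) _; rewrite lecR lerDr mulr_ge0 // ltW //.
    rewrite distrC; apply: le_trans (qq _ _ t0 ts sd) _.
    by rewrite lecR lerDl mulr_ge0 // ltW.
  exists a => z zd.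
  have [->|z0] := eqVneq z 0.
    by rewrite scale0r H0 mul0r subrr !normr0 expr0n mulr0.
  have [t t0 tE] : exists2 t, 0 < t & `|z| = real_complex R t.
    by apply: gt0_realC; rewrite normr_gt0.
  have td : 0 < t < d' by rewrite t0 -ltcR -tE -dE.
  have := aP (exist _ t td); rewrite /= => aqt.
  have tC : 0 < real_complex R t by rewrite ltcR.
  have tE' : `|real_complex R t| = real_complex R t by rewrite gtr0_norm.
  (* Homogeneity for the unit scalar [c] carries the estimate from the real number [t = |z|] to [z].
     The errors [A] from homogeneity and [2 * A] from the common point add up to [3 * A]. *)
  pose c := z / real_complex R t.
  have cn : `|c| = 1.
    by rewrite normrM normfV tE' tE divff // gt_eqF.
  have zE : z = c * real_complex R t by rewrite divfK // gt_eqF.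
  have := HZ c (real_complex R t *: e); rewrite cn scalerA -zE mul1r.
  have ted : `|real_complex R t *: e| < d.
    by apply: le_lt_trans (ze _) _; rewrite tE' -tE.
  move=> /(_ (lexx 1) ted) h.
  have {}h : `|H (z *: e) - c * H (real_complex R t *: e)| <= A * `|z| ^+ 2.
    apply: le_trans h _; rewrite ler_wpM2l // lerXn2r ?nnegrE //.
    by rewrite tE -[leRHS]tE'; exact: ze.
  have zq : c * H (real_complex R t *: e) - z * a = z * (q t - a).
    by rewrite mulrBr /q /c; congr (_ - _); rewrite mulrAC mulrA.
  rewrite -(subrKA (c * H (real_complex R t *: e))) zq.
  apply: le_trans (ler_normD _ _) _.
  have -> : 3%:R * A * `|z| ^+ 2 = A * `|z| ^+ 2 + `|z| * (2%:R * (A * `|z|)) by ring.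
  apply: lerD => //; rewrite normrM ler_wpM2l //; apply: le_trans aqt _.
  by rewrite AE tE !(rmorphM (real_complex R)) rmorph_nat.
have [a aP] := choice ray.
exists a, (n%:R * (A * n.+1%:R ^+ 2 + 3%:R * A)) => [|w wd].
  by rewrite mulr_ge0 // addr_ge0 // mulr_ge0 // exprn_ge0.
pose S (s : seq 'I_n) := \sum_(i <- s) w 0 i *: (delta_mx 0 i : 'rV[C]_n).
have we i : `|w 0 i *: (delta_mx 0 i : 'rV[C]_n)| <= `|w|.
  rewrite normrZ; apply: le_trans (norm_coord_le w i); rewrite ler_piMr //.
  exact: norm_delta_le.
have nS s : `|S s| <= `|w| *+ size s.
  elim: s => [|i s IH]; first by rewrite /S big_nil normr0.
  rewrite /S big_cons mulrS; apply: le_trans (ler_normD _ _) _; exact: lerD.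
have wle : `|w| < d by apply: le_lt_trans wd; rewrite mulrS lerDl mulrn_wge0.
pose D := A * n.+1%:R ^+ 2 + 3%:R * A.
have D0 : 0 <= D by rewrite addr_ge0 // mulr_ge0 // exprn_ge0.
(* The coordinates of [w] are added one by one; each costs one additivity error and one error along
   an axis. *)
have claim s : (size s <= n)%N ->
    `|H (S s) - \sum_(i <- s) w 0 i * a i| <= (size s)%:R * D * `|w| ^+ 2.
  elim: s => [_|i s IH sn].
    by rewrite /S !big_nil H0 subrr normr0 !mul0r.
  have Sd : `|S s| < d.
    apply: le_lt_trans (nS s) _; apply: le_lt_trans wd; apply: ler_wpMn2l => //.
    exact: leqW (ltnW sn).
  rewrite /S !big_cons -/(S s); set u := _ *: _.
  have ud : `|u| < d by apply: le_lt_trans (we i) _.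
  have wid : `|w 0 i| < d by apply: le_lt_trans (norm_coord_le w i) _.
  have -> : H (u + S s) - (w 0 i * a i + \sum_(j <- s) w 0 j * a j) =
     (H (u + S s) - H u - H (S s)) + (H u - w 0 i * a i) +
     (H (S s) - \sum_(j <- s) w 0 j * a j) by ring.
  have -> : (size (i :: s))%:R * D * `|w| ^+ 2 =
     A * n.+1%:R ^+ 2 * `|w| ^+ 2 + 3%:R * A * `|w| ^+ 2 + (size s)%:R * D * `|w| ^+ 2.
    by rewrite /= -natr1 /D; ring.
  apply: le_trans (ler_normD _ _) _; apply: lerD; last exact/IH/ltnW.
  apply: le_trans (ler_normD _ _) _; apply: lerD.
    apply: le_trans (HD _ _ ud Sd) _; rewrite -mulrA -exprMn ler_wpM2l //.
    rewrite lerXn2r ?nnegrE ?addr_ge0 ?mulr_ge0 // mulrC mulr_natr.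
    apply: le_trans (lerD (we i) (nS s)) _; rewrite -mulrS ler_wpMn2l //.
    exact: leqW.
  apply: le_trans (aP i _ wid) _; rewrite ler_wpM2l ?mulr_ge0 //.
  by rewrite lerXn2r ?nnegrE // norm_coord_le.
have := claim (enum 'I_n); rewrite size_enum_ord /S !big_enum /= => /(_ (leqnn n)).
by rewrite -row_sum_delta.
Qed.

End HolomorphicDerivative.

Section DifferentiableDerive.
Variable K : numFieldType.
Hypothesis mean_value : mean_value_property K.
Hypothesis cauchy : cauchy_property K.
Hypothesis almost_linear : almost_linear_property K.

(** [second_order] and [almost_linear] give a linear form [g] matching the increments of ['D_v f] at
    [x0] up to a quadratic error. Hence ['D_v f - g] has differential 0 there. *)
Lemma differentiable_derive n (U : set 'rV[K]_n) (f : 'rV[K]_n -> K^o) v : open U ->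
  (forall x, U x -> differentiable f x) ->
  forall x, U x -> differentiable (fun y => 'D_v f y) x.
Proof.
move=> oU df x0 Ux0.
have nb (A : set 'rV[K]_n) : nbhs x0 A -> exists2 e, 0 < e & forall u, `|u| < e -> A (x0 + u).
  move=> /nbhs_normP[e /= e0 eP]; exists e => // u ue; apply: eP => /=.
  by rewrite opprD addrA subrr sub0r normrN.
have [e e0 eP] : exists2 e, 0 < e & forall u, `|u| < e ->
    differentiable f (x0 + u) /\ `|f (x0 + u)| <= `|f x0| + 1.
  apply: (nb [set y | differentiable f y /\ `|f y| <= `|f x0| + 1]).
  have cf := differentiable_continuous (df _ Ux0).
  have h1 : nbhs x0 U by exact: open_nbhs_nbhs.
  have h2 : nbhs x0 [set y | `|f x0 - f y| < 1] by move/cvgrPdist_lt: cf; apply.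
  apply: filterS2 h1 h2 => y /df dfy /= h; split=> //.
  rewrite -[f y](subrK (f x0)) addrC; apply: le_trans (ler_normD _ _) _.
  by rewrite lerD2l distrC ltW.
have d0 : 0 < e / 5%:R by rewrite divr_gt0.
have [|A A0 HA] := second_order mean_value cauchy d0 (f := f) (x0 := x0) (M := `|f x0| + 1).
  by move=> u; rewrite -(mulr_natr (e / 5%:R) 5) divfK ?pnatr_eq0 //; exact: eP.
move: (e / 5%:R) d0 HA => d dgt HA.
have [HD HZ] := HA v.
have d20 : 0 < d / 2 by rewrite divr_gt0.
have [|a [B B0 aB]] := almost_linear d20 _ HD HZ; first by rewrite mulr_ge0.
pose g (y : 'rV[K]_n) : K^o := \sum_i (y 0 i * a i).
have dg : differentiable g x0.
  rewrite (_ : g = \sum_(i < n) (fun y : 'rV[K]_n => y 0 i * a i : K^o)); last first.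
    by apply/funext => y; rewrite fct_sumE.
  apply: differentiable_sum => i; apply: differentiableM; last exact: differentiable_cst.
  exact: differentiable_coord.
have -> : (fun y => 'D_v f y) = ((fun y => 'D_v f y) - g) + g.
  by apply/funext => y; rewrite !fctE subrK.
apply: differentiableD => //; apply: has_diff0_differentiable => eps eps0.
have B1 : 0 < eps / (B + 1) by rewrite divr_gt0 // ltr_wpDl.
have dn : 0 < d / 2 / n.+1%:R by rewrite divr_gt0.
have [c1 c10 [c1e c1d]] := gt0_below e0 dn.
have [c c0 [cc1 cB]] := gt0_below c10 B1.
exists c => // w wc; have we : `|w| < e by apply: lt_le_trans wc (le_trans cc1 c1e).
have wd : `|w| *+ n.+1 < d / 2.
  rewrite -[ltRHS](divfK (x := n.+1%:R)) ?pnatr_eq0 // mulr_natr ltrMn2r.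
  exact: lt_le_trans wc (le_trans cc1 c1d).
have wB : `|w| * (B + 1) <= eps.
  by rewrite -ler_pdivlMr ?ltr_wpDl //; apply: le_trans (ltW wc) cB.
rewrite !fctE subr0.
rewrite (deriveE v (eP w we).1) (deriveE v (df _ Ux0)).
have -> : 'd f (x0 + w) v - g (x0 + w) - ('d f x0 v - g x0) =
  ('d f (x0 + w) v - 'd f x0 v) - \sum_i w 0 i * a i.
  have -> : g (x0 + w) = g x0 + \sum_i w 0 i * a i.
    by rewrite /g -big_split; apply: eq_bigr => i _; rewrite mxE mulrDl.
  have alg (p q b s : K) : p - (b + s) - (q - b) = p - q - s by ring.
  exact: alg.
apply: le_trans (aB w wd) _; rewrite expr2 mulrA; apply: ler_wpM2r => //.
by apply: le_trans wB; rewrite mulrC ler_wpM2l // lerDl.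
Qed.
End DifferentiableDerive.

(** * Taylor expansions with locally bounded coefficients *)

Lemma is_derive_horner (K : numFieldType) (p : {poly K}) (t : K) :
  is_derive t (1 : K) (fun z : K => p.[z]) p^`().[t].
Proof.
elim/poly_ind: p => [|p c IH].
  rewrite deriv0 horner0 (_ : (fun z => _) = cst 0); first exact: is_derive_cst.
  by apply/funext => z; rewrite horner0.
have -> : (fun z => (p * 'X + c%:P).[z]) = (fun z => p.[z]) * id + cst c.
  by apply/funext => z; rewrite !hornerE.
apply: is_derive_eq; rewrite derivD derivM derivX derivC !hornerE.
by rewrite [_%:A]mulr1 addrC [t *: _]mulrC.
Qed.

Lemma diff_horner (K : numFieldType) (p : {poly K}) (t : K^o) :
  differentiable (horner p : K^o -> K^o) t /\
  'd (horner p : K^o -> K^o) t 1 = p^`().[t].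
Proof.
have dp : is_derive (t : K^o) (1 : K^o) (horner p : K^o -> K^o) p^`().[t].
  exact: is_derive_horner.
have dp' : differentiable (horner p : K^o -> K^o) t.
  by apply/derivable1_diffP; apply: ex_derive.
by split=> //; rewrite -(deriveE _ dp'); exact: (@derive_val _ _ _ _ _ _ _ dp).
Qed.

Section Taylor.
Variables (K : numFieldType) (n : nat).
Hypothesis mean_value : mean_value_property K.
Local Notation V := 'rV[K]_n.
Implicit Types (h : V -> K^o) (x y u s : V).

Definition partial (a : 'I_n) h : V -> K^o := fun y => 'D_(delta_mx 0 a) h y.

Lemma diff_partial h x u : differentiable h x ->
  'd h x u = \sum_a u 0 a * partial a h x.
Proof.
move=> dh; rewrite {1}(row_sum_delta u) linear_sum; apply: eq_bigr => a _.
by rewrite linearZ /partial deriveE.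
Qed.

Lemma Cinfty_partial U h a : Cinfty U h -> Cinfty U (partial a h).
Proof. by move=> hU m; have [_] := hU m.+1; exact. Qed.

(* The i-th derivative of t |-> h (x + t u) at t = 0. *)
Fixpoint taylor_term i h x u : K :=
  if i is j.+1 then \sum_a u 0 a * taylor_term j (partial a h) x u else h x.

Lemma taylor_termZ i h x (t : K) u :
  taylor_term i h x (t *: u) = t ^+ i * taylor_term i h x u.
Proof.
elim: i h => [|i IH] h /=; first by rewrite expr0 mul1r.
rewrite mulr_sumr; apply: eq_bigr => a _; rewrite IH mxE exprS; ring.
Qed.

Lemma common_radius (r : 'I_n -> K) (r0 : K) : 0 < r0 -> (forall a, 0 < r a) ->
  exists2 d, 0 < d & d <= r0 /\ forall a, d <= r a.
Proof.
move=> r00 rp; suff [d d0 [dr0 dr]] : exists2 d, 0 < d & d <= r0 /\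
    forall a, a \in enum 'I_n -> d <= r a.
  by exists d => //; split=> // a; apply: dr; rewrite mem_enum.
elim: (enum 'I_n) => [|a l [d d0 [dr0 dl]]]; first by exists r0.
have [e e0 [ed er]] := gt0_below d0 (rp a).
exists e => //; split; first exact: le_trans dr0.
move=> b; rewrite inE => /orP[/eqP->//|/dl]; exact: le_trans.
Qed.

Lemma near_radius (P : V -> Prop) s : (\forall x \near s, P x) ->
  exists2 r, 0 < r & forall x, `|x - s| < r -> P x.
Proof.
move=> /nbhs_normP[r /= r0 rP]; exists r => // x xr; apply: rP => /=.
by rewrite distrC.
Qed.

Lemma near_bounded h s : {for s, continuous h} ->
  exists2 r, 0 < r & forall x, `|x - s| < r -> `|h x| <= `|h s| + 1.
Proof.
move=> ch; apply: (@near_radius (fun x => `|h x| <= `|h s| + 1)).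
have : nbhs s [set y | `|h s - h y| < 1] by move/cvgrPdist_lt: ch; apply.
apply: filterS => y /= hy; rewrite -[h y](subrK (h s)) addrC.
by apply: le_trans (ler_normD _ _) _; rewrite lerD2l distrC ltW.
Qed.

(** Induction on [N], for all [h] at once: along the segment from [x] to [y], the derivative of the
    remainder of [h] is a combination of the remainders of its partial derivatives. The radius and
    the constant depend on [s] only, not on [x]. *)
Lemma taylor_remainder U s N h : open U -> U s -> Cinfty U h ->
  exists2 r, 0 < r & exists2 C, 0 <= C & forall x y, `|x - s| < r -> `|y - s| < r ->
    `|h y - \sum_(i < N) (i`!%:R)^-1 * taylor_term i h x (y - x)| <= C * `|y - x| ^+ N.
Proof.
move=> oU Us; elim: N h => [|N IH] h hU.
  have [r r0 rP] := near_bounded (hU 0%N s Us).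
  exists r => //; exists (`|h s| + 1); first by rewrite addr_ge0.
  by move=> x y _ yr; rewrite big_ord0 subr0 expr0 mulr1; exact: rP.
have [r rP] := choice (fun a => let: ex_intro2 r r0 p := IH _ (Cinfty_partial a hU) in
  ex_intro (fun r => 0 < r /\ exists2 C, 0 <= C & forall x y, `|x - s| < r -> `|y - s| < r ->
    `|partial a h y - \sum_(i < N) (i`!%:R)^-1 * taylor_term i (partial a h) x (y - x)|
      <= C * `|y - x| ^+ N) r (conj r0 p)).
have [C CP] := choice (fun a => let: conj _ (ex_intro2 C C0 p) := rP a in
  ex_intro (fun C => 0 <= C /\ forall x y, `|x - s| < r a -> `|y - s| < r a ->
    `|partial a h y - \sum_(i < N) (i`!%:R)^-1 * taylor_term i (partial a h) x (y - x)|
      <= C * `|y - x| ^+ N) C (conj C0 p)).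
have [rU rU0 UP] : exists2 r, 0 < r & forall x, `|x - s| < r -> U x.
  by apply: near_radius; exact: open_nbhs_nbhs.
have [d d0 [dU dr]] := common_radius rU0 (fun a => (rP a).1).
exists d => //; exists (\sum_a C a); first by apply: sumr_ge0 => a _; have [] := CP a.
move=> x y xd yd; set u := y - x.
have seg (t : K) : 0 <= t <= 1 -> `|x + t *: u - s| < d.
  move=> /andP[t0 t1]; have -> : x + t *: u - s = (1 - t) *: (x - s) + t *: (y - s).
    rewrite /u !scalerBr !scalerBl !scale1r; apply/rowP => a; rewrite !mxE; ring.
  apply: le_lt_trans (ler_normD _ _) _; rewrite !normrZ !ger0_norm ?subr_ge0 //.
  have [->|tn0] := eqVneq t 0; first by rewrite subr0 mul1r mul0r addr0.
  have -> : d = (1 - t) * d + t * d by rewrite -mulrDl subrK mul1r.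
  apply: ler_ltD; first by rewrite ler_wpM2l ?subr_ge0 // ltW.
  by rewrite ltr_pM2l // lt_def tn0.
(* The Taylor polynomial restricted to the segment, as a polynomial in the parameter [t]. *)
pose p : {poly K} := \poly_(i < N.+1) ((i`!%:R)^-1 * taylor_term i h x u).
pose G (t : K^o) : K^o := h (x + t *: u) - p.[t].
have pE (t : K) : p.[t] = \sum_(i < N.+1) (i`!%:R)^-1 * taylor_term i h x (t *: u).
  rewrite horner_poly; apply: eq_bigr => i _; rewrite taylor_termZ; ring.
have G1 : G 1 - G 0 - 0 =
    h y - \sum_(i < N.+1) (i`!%:R)^-1 * taylor_term i h x u.
  have p0 : p.[0] = h x.
    by rewrite horner_coef0 coef_poly /= fact0 invr1 mul1r.
  by rewrite /G p0 pE !scale1r scale0r addr0 subr0 subrr subr0 [x + u]addrC subrK.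
rewrite -G1 -[X in G X - _]add0r.
apply: (mean_value (V := K^o)) => t t01.
have yt : `|x + t *: u - s| < d by exact: seg.
rewrite add0r [t *: (1 : K^o)]mulr1.
have dh : differentiable h (x + t *: u).
  by have [dh _] := hU 1%N; apply: dh; apply: UP; apply: lt_le_trans yt dU.
have [dl dlE] := differentiable_line dh.
have [dp' dpE] := diff_horner p t.
split; first exact: differentiableB.
rewrite subr0 (_ : 'd G t 1 = \sum_a u 0 a * (partial a h (x + t *: u) -
    \sum_(i < N) (i`!%:R)^-1 * taylor_term i (partial a h) x (t *: u))).
  apply: le_trans (ler_norm_sum _ _ _) _; rewrite mulr_suml; apply: ler_sum => a _.
  have [C0 Ca] := CP a; rewrite normrM exprS mulrCA; apply: ler_pM => //.
    exact: norm_coord_le.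
  have tu : t *: u = x + t *: u - x by rewrite addrAC subrr add0r.
  rewrite {2}tu; apply: le_trans (Ca _ _ _ _) _.
  - exact: lt_le_trans xd (dr a).
  - exact: lt_le_trans yt (dr a).
  rewrite -tu ler_wpM2l // lerXn2r ?nnegrE // normrZ ler_piMl //.
  by case/andP: t01 => t0 t1; rewrite ger0_norm.
have -> : 'd G t 1 = 'd h (x + t *: u) u - p^`().[t].
  have -> : 'd G t 1 = 'd (fun z : K^o => h (x + z *: u)) t 1 -
      'd (horner p : K^o -> K^o) t 1 by exact: diffB_val.
  by rewrite dlE dpE.
rewrite (diff_partial _ dh) {1}/p.
have -> : p^`().[t] = \sum_a u 0 a *
    \sum_(i < N) (i`!%:R)^-1 * taylor_term i (partial a h) x (t *: u).
  rewrite /p poly_def raddf_sum /= horner_sum big_ord_recl.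
  rewrite [X in X + _](_ : _ = 0); last first.
    by rewrite derivZ derivXn mulr0n scaler0 horner0.
  rewrite add0r; under [RHS]eq_bigr do rewrite mulr_sumr.
  rewrite exchange_big; apply: eq_bigr => i _ /=.
  rewrite /bump /= add1n derivZ derivXn hornerZ hornerMn hornerXn.
  under [RHS]eq_bigr do rewrite taylor_termZ mulrCA [X in _ * X]mulrCA mulrA.
  rewrite -[RHS]mulr_sumr factS natrM -(mulr_natr (t ^+ i.+1.-1)) /=.
  move: (\sum_a _) => T.
  have f0 : i`!%:R != 0 :> K by rewrite pnatr_eq0 -lt0n fact_gt0.
  have i0 : i.+1%:R != 0 :> K by rewrite pnatr_eq0.
  move: (i`!%:R) (i.+1%:R) f0 i0 => f m f0 m0; field; exact/andP.
rewrite -sumrB; apply: eq_bigr => a _; rewrite mulrBr //.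
Qed.

(** Polynomials in [y] whose coefficients depend on [x] and stay bounded near [s]. The index type is
    arbitrary, so sums are disjoint unions and no monomials have to be collected. *)
Definition bounded_poly s N (q : V -> V -> K) : Prop :=
  exists (I : finType) (w : I -> seq 'I_n) (c : I -> V -> K) (C r : K),
  [/\ 0 < r, forall i, (size (w i) <= N)%N,
    forall x i, `|x - s| < r -> `|c i x| <= C &
    forall x y, q x y = \sum_i c i x * mon (w i) y].

(** When there are no terms, [C] may be negative and is replaced by 0. *)
Lemma bounded_poly_bound s N q : bounded_poly s N q ->
  exists (I : finType) (w : I -> seq 'I_n) (c : I -> V -> K) (C r : K),
  [/\ 0 < r /\ 0 <= C, forall i, (size (w i) <= N)%N,
    forall x i, `|x - s| < r -> `|c i x| <= C &
    forall x y, q x y = \sum_i c i x * mon (w i) y].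
Proof.
move=> [I [w [c [C [r [r0 sw cC qE]]]]]].
have [i0|noI] := pselect (inhabited I); last first.
  by exists I, w, c, 0, r; split=> // x i; case: noI; exists.
exists I, w, c, C, r; split=> //; split=> //; case: i0 => i0.
by apply: le_trans (cC s i0 _); rewrite // subrr normr0.
Qed.

Lemma bounded_polyD s N p q : bounded_poly s N p -> bounded_poly s N q ->
  bounded_poly s N (fun x y => p x y + q x y).
Proof.
move=> /bounded_poly_bound[I [w [c [C [r [[r0 C0] sw cC pE]]]]]].
move=> /bounded_poly_bound[J [v [d [D [t [[t0 D0] sv dD qE]]]]]].
have [e e0 [er et]] := gt0_below r0 t0.
exists (I + J)%type, (fun i => match i with inl i => w i | inr j => v j end).
exists (fun i => match i with inl i => c i | inr j => d j end), (C + D), e.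
split=> // [[i|j] //|x [i|j] xe|x y].
- by apply: le_trans (cC x i _) _; rewrite ?lerDl //; apply: lt_le_trans xe er.
- by apply: le_trans (dD x j _) _; rewrite ?lerDr //; apply: lt_le_trans xe et.
by rewrite big_sumType /= pE qE.
Qed.

Lemma bounded_poly0 s N : bounded_poly s N (fun _ _ => 0).
Proof.
exists void, (fun=> [::]), (fun _ _ => 0), 0, 1.
split=> // x y.
by rewrite big1 // => -[].
Qed.

Lemma bounded_poly_sum s N (J : Type) (l : seq J) (q : J -> V -> V -> K) :
  (forall a, bounded_poly s N (q a)) ->
  bounded_poly s N (fun x y => \sum_(a <- l) q a x y).
Proof.
move=> qP; elim: l => [|a l IH].
  rewrite (_ : (fun _ _ => _) = (fun _ _ => 0)); first exact: bounded_poly0.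
  by apply/funext => x; apply/funext => y; rewrite big_nil.
rewrite (_ : (fun _ _ => _) = (fun x y => q a x y + \sum_(a <- l) q a x y)).
  exact: bounded_polyD.
by apply/funext => x; apply/funext => y; rewrite big_cons.
Qed.

Lemma bounded_poly_scale s N c0 C0 r0 q : 0 < r0 ->
  (forall x, `|x - s| < r0 -> `|c0 x| <= C0) ->
  bounded_poly s N q -> bounded_poly s N (fun x y => c0 x * q x y).
Proof.
move=> r00 c0C [I [w [c [C [r [r0' sw cC qE]]]]]].
have [e e0 [er et]] := gt0_below r00 r0'.
exists I, w, (fun i x => c0 x * c i x), (C0 * C), e; split=> // [x i xe|x y].
  rewrite normrM ler_pM //; [apply: c0C|apply: cC]; exact: lt_le_trans xe _.
by rewrite qE mulr_sumr; apply: eq_bigr => i _; rewrite mulrA.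
Qed.

Lemma bounded_poly_coord s N a q : bounded_poly s N q ->
  bounded_poly s N.+1 (fun x y => y 0 a * q x y).
Proof.
move=> [I [w [c [C [r [r0 sw cC qE]]]]]].
exists I, (fun i => a :: w i), c, C, r; split=> // x y.
by rewrite qE mulr_sumr; apply: eq_bigr => i _; rewrite /mon big_cons mulrCA.
Qed.

Lemma bounded_poly_le s N M q : (N <= M)%N -> bounded_poly s N q -> bounded_poly s M q.
Proof.
move=> NM [I [w [c [C [r [r0 sw cC qE]]]]]]; exists I, w, c, C, r; split=> // i.
exact: leq_trans (sw i) NM.
Qed.

Lemma bounded_poly_taylor_term U s i h : U s -> Cinfty U h ->
  bounded_poly s i (fun x y => taylor_term i h x (y - x)).
Proof.
move=> Us; elim: i h => [|i IH] h hU /=.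
  have [r r0 rP] := near_bounded (hU 0%N s Us).
  exists unit, (fun=> [::]), (fun _ => h), (`|h s| + 1), r.
  split=> // [x _|x y]; first exact: rP.
  by rewrite (big_pred1 tt) /mon ?big_nil ?mulr1 //; case.
apply: bounded_poly_sum => a; have IHa := IH _ (Cinfty_partial a hU).
have -> : (fun x y => (y - x) 0 a * taylor_term i (partial a h) x (y - x)) =
  (fun x y => y 0 a * taylor_term i (partial a h) x (y - x) +
    (- x 0 a) * taylor_term i (partial a h) x (y - x)).
  by apply/funext => x; apply/funext => y; rewrite !mxE mulrDl.
apply: bounded_polyD; first exact: bounded_poly_coord.
apply: (@bounded_poly_le _ i) => //.
apply: (@bounded_poly_scale s i (fun x => - x 0 a) (`|s| + 1) 1) => // x xs.
rewrite normrN; apply: le_trans (norm_coord_le x a) _.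
by rewrite -[x](subrK s) addrC; apply: le_trans (ler_normD _ _) _; rewrite lerD2l ltW.
Qed.

(** The Taylor polynomial at [x] is expanded in powers of [y] instead of [y - x]: the monomials then
    stay the same while [x] moves, and only the bounded coefficients vary. *)
Lemma taylor U s N h : open U -> U s -> Cinfty U h ->
  exists (I : finType) (w : I -> seq 'I_n) (c : I -> V -> K) (C r : K),
  [/\ 0 < r /\ 0 <= C, forall i, (size (w i) <= N)%N,
    forall x i, `|x - s| < r -> `|c i x| <= C &
    forall x y, `|x - s| < r -> `|y - s| < r ->
      `|h y - \sum_i c i x * mon (w i) y| <= C * `|y - x| ^+ N.+1].
Proof.
move=> oU Us hU.
have [r1 r10 [C1 C10 h1]] := taylor_remainder N.+1 oU Us hU.
have /bounded_poly_bound[I [w [c [C [r [[r0 C0] sw cC qE]]]]]] :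
    bounded_poly s N (fun x y => \sum_(i < N.+1) (i`!%:R)^-1 * taylor_term i h x (y - x)).
  apply: bounded_poly_sum => i.
  apply: (@bounded_poly_scale s N (fun=> (i`!%:R)^-1) `|(i`!%:R)^-1| 1) => //.
  apply: (@bounded_poly_le _ i); first by rewrite -ltnS.
  exact: bounded_poly_taylor_term hU.
have [e e0 [er e1]] := gt0_below r0 r10.
exists I, w, c, (C + C1), e; split=> //.
- by rewrite addr_ge0.
- by move=> x i xe; apply: le_trans (cC _ _ (lt_le_trans xe er)) _; rewrite lerDl.
move=> x y xe ye; rewrite -qE.
apply: le_trans (h1 x y (lt_le_trans xe e1) (lt_le_trans ye e1)) _.
by rewrite ler_wpM2r ?exprn_ge0 // lerDr.
Qed.
End Taylor.

(** * Jets along formal curves *)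

Lemma diff_coord (K : numFieldType) (V : normedModType K) m (G : V -> 'rV[K]_m) x a :
  differentiable G x -> differentiable (fun y => G y 0 a : K^o) x /\
  forall v, 'd (fun y => G y 0 a : K^o) x v = 'd G x v 0 a.
Proof.
move=> dG.
have @f : {linear 'rV[K]_m -> K^o}.
  by exists (fun N : 'rV[K]_m => N 0 a : K^o); do 2![eexists]; do ?[constructor];
     rewrite ?mxE// => ? *; rewrite ?mxE//; move=> ?; rewrite !mxE.
have cf : continuous f by exact: coord_continuous.
have df : differentiable f (G x) by exact: linear_differentiable.
split; first exact: (@differentiable_comp _ _ _ _ G f).
move=> v; rewrite -[LHS]/('d (f \o G) x v) (diff_comp dG df).
by rewrite -[LHS]/('d f (G x) ('d G x v)) (diff_lin _ cf).
Qed.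

(** * Orders of vanishing *)

Section BigO.
Variable K : numFieldType.
Implicit Types (p : {poly K}) (G : K -> K).

(* G t = O (t ^ m) as t tends to 0 (with t = 0 included). *)
Definition orderO m G : Prop := exists2 r : K, 0 < r & exists2 B : K, 0 <= B &
  forall t, `|t| < r -> `|G t| <= B * `|t| ^+ m.

Lemma orderOD m G H : orderO m G -> orderO m H -> orderO m (fun t => G t + H t).
Proof.
move=> [r r0 [B B0 GB]] [r' r'0 [B' B'0 HB]].
have [e e0 [er er']] := gt0_below r0 r'0.
exists e => //; exists (B + B') => [|t te]; first exact: addr_ge0.
rewrite mulrDl; apply: le_trans (ler_normD _ _) _.
by apply: lerD; [apply: GB|apply: HB]; exact: lt_le_trans te _.
Qed.

Lemma orderO_eq m G H : (forall t, G t = H t) -> orderO m G -> orderO m H.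
Proof. by move=> GH; have -> : H = G by apply/funext. Qed.

Lemma orderOM m m' G H : orderO m G -> orderO m' H -> orderO (m + m') (fun t => G t * H t).
Proof.
move=> [r r0 [B B0 GB]] [r' r'0 [B' B'0 HB]].
have [e e0 [er er']] := gt0_below r0 r'0.
exists e => //; exists (B * B') => [|t te]; first exact: mulr_ge0.
rewrite normrM exprD mulrACA.
by apply: ler_pM => //; [apply: GB|apply: HB]; exact: lt_le_trans te _.
Qed.

Lemma orderOZ m c G : orderO m G -> orderO m (fun t => c * G t).
Proof.
move=> [r r0 [B B0 GB]]; exists r => //; exists (`|c| * B) => [|t tr].
  exact: mulr_ge0.
by rewrite normrM -mulrA ler_wpM2l //; exact: GB.
Qed.

Lemma orderO0 m : orderO m (fun=> 0).
Proof. by exists 1 => //; exists 0 => // t _; rewrite normr0 mul0r. Qed.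

Lemma orderO_sum m (I : Type) (l : seq I) (G : I -> K -> K) :
  (forall i, orderO m (G i)) -> orderO m (fun t => \sum_(i <- l) G i t).
Proof.
move=> GO; elim: l => [|i l IH].
  by apply: orderO_eq (orderO0 m) => t; rewrite big_nil.
by apply: orderO_eq (orderOD (GO i) IH) => t; rewrite big_cons.
Qed.

Lemma orderO_le m m' G : (m <= m')%N -> orderO m' G -> orderO m G.
Proof.
move=> mm [r r0 [B B0 GB]]; have [e e0 [er e1]] := gt0_below r0 (@ltr01 K).
exists e => //; exists B => // t te.
have te1 : `|t| <= 1 by apply: ltW; exact: lt_le_trans te e1.
apply: le_trans (GB t (lt_le_trans te er)) _; rewrite ler_wpM2l //.
exact: ler_wiXn2l.
Qed.

Lemma horner_small m p t : (forall i, (i < m)%N -> p`_i = 0) -> `|t| < 1 ->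
  `|p.[t]| <= (\sum_(i < size p) `|p`_i|) * `|t| ^+ m.
Proof.
move=> p0 t1.
rewrite horner_coef mulr_suml; apply: le_trans (ler_norm_sum _ _ _) _.
apply: ler_sum => i _; rewrite normrM normrX.
have [im|mi] := ltnP i m; first by rewrite p0 // normr0 !mul0r.
by rewrite ler_wpM2l // ler_wiXn2l // ltW.
Qed.

Lemma horner_orderO m p : (forall i, (i < m)%N -> p`_i = 0) -> orderO m (horner p).
Proof.
move=> p0; exists 1 => //; exists (\sum_(i < size p) `|p`_i|) => [|t].
  exact: sumr_ge0.
exact: horner_small.
Qed.

Lemma orderO_coef0 m p : orderO m (horner p) -> forall i, (i < m)%N -> p`_i = 0.
Proof.
(* The induction divides by ['X], which loses the estimate at [t = 0]; hence the weaker hypothesis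
   on a punctured neighbourhood. *)
suff punctured : (exists2 r : K, 0 < r & exists2 B : K, 0 <= B &
    forall t, t != 0 -> `|t| < r -> `|p.[t]| <= B * `|t| ^+ m) ->
    forall i, (i < m)%N -> p`_i = 0.
  move=> [r r0 [B B0 pB]]; apply: punctured; exists r => //.
  by exists B => // t _; exact: pB.
elim: m p => [//|m IH] p [r r0 [B B0 pB]].
have p0 : p`_0 = 0.
  apply/eqP; apply: contraT => pn0.
  have [r1 r10 [D D0 Dp]] : orderO 1 (horner (p - (p`_0)%:P)).
    apply: horner_orderO => -[|//] _; by rewrite coefB coefC subrr.
  have q0 : 0 < `|p`_0| / (B + D + 1).
    by rewrite divr_gt0 ?normr_gt0 // ltr_wpDl // addr_ge0.
  have [e1 e10 [e1r e1r1]] := gt0_below r0 r10.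
  have [e2 e20 [e21 e2q]] := gt0_below q0 (@ltr01 K).
  have [t t0 [te1 te2]] := gt0_below e10 e20.
  have t20 : 0 < t / 2 by rewrite divr_gt0.
  have tn : `|t / 2| = t / 2 by rewrite gtr0_norm.
  have tt : t / 2 < t by rewrite ltr_pdivrMr // ltr_pMr // ltr1n.
  have h1 := pB _ (lt0r_neq0 t20); have h2 := Dp (t / 2).
  rewrite !tn in h1 h2; move: (t / 2) t20 {tn} tt h1 h2 => u u0 ut h1 h2.
  have {}h1 := h1 (lt_le_trans ut (le_trans te1 e1r)).
  have {}h2 := h2 (lt_le_trans ut (le_trans te1 e1r1)).
  rewrite hornerD hornerN hornerC expr1 in h2.
  have u1 : u <= 1 by apply: ltW (lt_le_trans ut (le_trans te2 e2q)).
  have : `|p`_0| <= (B + D) * u.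
    have -> : p`_0 = p.[u] - (p.[u] - p`_0) by rewrite opprB addrC subrK.
    apply: le_trans (ler_normB _ _) _; rewrite mulrDl; apply: lerD => //.
    by apply: le_trans h1 _; rewrite ler_wpM2l // exprS ler_piMr ?exprn_ile1 // ltW.
  have : (B + D) * u < `|p`_0|.
    have uq : u < `|p`_0| / (B + D + 1) by apply: lt_le_trans ut (le_trans te2 e21).
    rewrite ltr_pdivlMr ?ltr_wpDl ?addr_ge0 // in uq.
    by apply: le_lt_trans uq; rewrite mulrC ler_wpM2l ?lerDl // ltW.
  by move=> h /(lt_le_trans h); rewrite ltxx.
have [q pE] : exists q, p = q * 'X.
  have /factor_theorem[q] : root p 0 by rewrite /root horner_coef0 p0.
  by rewrite subr0 => ->; exists q.
move=> [|i] im; first exact: p0.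
rewrite pE coefMX /=; apply: IH => //; exists r => //; exists B => // t t0 tr.
have := pB t t0 tr; rewrite pE hornerMX normrM exprSr mulrA.
by rewrite ler_pM2r // normr_gt0.
Qed.

Lemma norm_row_le m (w : 'rV[K]_m) b : 0 <= b -> (forall a, `|w 0 a| <= b) -> `|w| <= b.
Proof.
move=> b0 wb; rewrite [leLHS]/Num.Def.normr /=.
by have [->//|/mx_norm_neq0[[i j] ->]] := eqVneq (mx_norm w) 0; rewrite (ord1 i).
Qed.

Lemma orderO_row m k (G : K -> 'rV[K]_k) :
  (forall a, orderO m (fun t => G t 0 a)) -> orderO m (fun t => `|G t|).
Proof.
move=> GO.
have /choice[r rP] a : exists r : K, 0 < r /\ exists2 B : K, 0 <= B &
    forall t, `|t| < r -> `|G t 0 a| <= B * `|t| ^+ m.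
  by have [r r0 h] := GO a; exists r.
have /choice[B BP] a : exists B : K, 0 <= B /\
    forall t, `|t| < r a -> `|G t 0 a| <= B * `|t| ^+ m.
  by have [_ [B B0 h]] := rP a; exists B.
have [d d0 [_ dr]] := common_radius (@ltr01 K) (fun a => (rP a).1).
have B0 a : 0 <= B a by have [] := BP a.
exists d => //; exists (\sum_a B a) => [|t td]; first exact: sumr_ge0.
rewrite normr_id; apply: norm_row_le => [|a].
  by rewrite mulr_ge0 ?exprn_ge0 // sumr_ge0.
have [_ h] := BP a; apply: le_trans (h t (lt_le_trans td (dr a))) _.
by rewrite ler_wpM2r ?exprn_ge0 // (bigD1 a) //= lerDl sumr_ge0.
Qed.

End BigO.

Section Jets.
Variables (K : numFieldType) (n N : nat).
Hypothesis mean_value : mean_value_property K.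
Local Notation V := 'rV[K]_n.
Local Notation W := (N.-bseq 'I_n).

(** A Taylor polynomial of order [N] at [x], written in powers of [y]. As several words may encode
    one monomial, [c] need not be unique. *)
Definition jet (x : V) (h : V -> K) (c : W -> K) : Prop :=
  exists2 C : K, 0 <= C & exists2 r, 0 < r & forall y, `|y - x| < r ->
    `|h y - \sum_w c w * mon w y| <= C * `|y - x| ^+ N.+1.

Lemma taylor_near (U : set V) s (h : V -> K^o) : open U -> U s -> Cinfty U h ->
  exists2 C : K, 0 <= C & \forall x \near s,
    exists2 c : W -> K, (forall w, `|c w| <= C) & jet x h c.
Proof.
move=> oU Us hU.
have [I [w [c [C [r [[r0 C0] sw cC hc]]]]]] := taylor mean_value N oU Us hU.
pose f i : W := Bseq (sw i).
(* Terms with the same word are collected, so at most [#|I|] coefficients are added. *)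
exists (C *+ #|I|); first exact: mulrn_wge0.
apply/nbhs_normP; exists r => // x /=; rewrite distrC => xr.
exists (fun v => \sum_(i | f i == v) c i x) => [v|].
  apply: le_trans (ler_norm_sum _ _ _) _.
  rewrite -sumr_const big_mkcond; apply: ler_sum => i _.
  by case: ifP => // _; exact: cC.
exists C => //; exists (r - `|x - s|); first by rewrite subr_gt0.
move=> y yx; have ys : `|y - s| < r.
  rewrite -(subrKA x); apply: le_lt_trans (ler_normD _ _) _.
  by rewrite -ltrBrDr.
apply: le_trans (hc x y xr ys); rewrite (partition_big f predT) //=.
rewrite le_eqVlt; apply/orP; left; apply/eqP; congr (`|_ - _|).
apply: eq_bigr => v _; rewrite mulr_suml; apply: eq_bigr => i /eqP <- //.
Qed.

Section Curve.
Variables (x : V) (g : 'I_n -> {poly K}).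
Hypothesis g0 : forall a, (g a)`_0 = x 0 a.

Definition curve (t : K^o) : V := \row_a (g a).[t].

Lemma curve0 : curve 0 = x.
Proof. by apply/rowP => a; rewrite mxE horner_coef0. Qed.

Lemma curve_orderO : orderO 1 (fun t => `|curve t - x|).
Proof.
apply: orderO_row => a; apply: (@orderO_eq _ _ (horner (g a - (x 0 a)%:P))).
  by move=> t; rewrite !mxE hornerD hornerN hornerC.
by apply: horner_orderO => -[|//] _; rewrite coefB coefC g0 subrr.
Qed.

Lemma curve_near r : 0 < r -> exists2 e, 0 < e & forall t, `|t| < e -> `|curve t - x| < r.
Proof.
move=> r0; have [d d0 [B B0 cB]] := curve_orderO.
have q0 : 0 < r / (B + 1) by rewrite divr_gt0 // ltr_wpDl.
have [e e0 [ed eq]] := gt0_below d0 q0.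
exists e => // t te; have := cB t (lt_le_trans te ed).
rewrite normr_id expr1 => /le_lt_trans; apply.
have := lt_le_trans te eq; rewrite ltr_pdivlMr ?ltr_wpDl //; apply: le_lt_trans.
by rewrite mulrC ler_wpM2l // lerDl.
Qed.

Lemma jet_curve h c : jet x h c -> orderO N.+1 (fun t => h (curve t) - (psum c g).[t]).
Proof.
move=> [C C0 [r r0 hc]]; have [e e0 er] := curve_near r0.
have [d d0 [B B0 cB]] := curve_orderO; have [q q0 [qe qd]] := gt0_below e0 d0.
exists q => //; exists (C * B ^+ N.+1) => [|t tq].
  by rewrite mulr_ge0 // exprn_ge0.
rewrite horner_psum; apply: le_trans (hc _ (er t (lt_le_trans tq qe))) _.
rewrite -mulrA -exprMn ler_wpM2l // lerXn2r ?nnegrE ?mulr_ge0 //.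
by have := cB t (lt_le_trans tq qd); rewrite normr_id expr1.
Qed.

Lemma diff_curve t : differentiable curve t /\
  'd curve t 1 = \row_a (g a)^`().[t].
Proof.
have dc : differentiable curve t.
  have -> : curve = \sum_(a < n) (fun t => (g a).[t] *: (delta_mx 0 a : V)).
    apply/funext => u; rewrite fct_sumE [curve u]row_sum_delta.
    by apply: eq_bigr => a _; rewrite mxE.
  by apply: differentiable_sum => a; apply: differentiableZl; have [] := diff_horner (g a) t.
split=> //; apply/rowP => a; have [_ <-] := diff_coord a dc.
have -> : (fun y => curve y 0 a : K^o) = (horner (g a) : K^o -> K^o).
  by apply/funext => u; rewrite mxE.
by have [_ ->] := diff_horner (g a) t; rewrite mxE.
Qed.

End Curve.

Lemma differentiable_lipschitz p (f : 'rV[K]_p -> K^o) y : differentiable f y ->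
  exists2 L : K, 0 <= L & exists2 r, 0 < r & forall w, `|w| < r ->
    `|f (y + w) - f y| <= L * `|w|.
Proof.
move=> df; have [r r0 rP] := differentiable_has_diff df (@ltr01 K).
have S0 : 0 <= \sum_a `|'d f y (delta_mx 0 a)| by apply: sumr_ge0.
exists (1 + \sum_a `|'d f y (delta_mx 0 a)|); first exact: addr_ge0.
exists r => // w wr; rewrite -[X in `|X|](subrK ('d f y w)).
apply: le_trans (ler_normD _ _) _; rewrite mulrDl; apply: lerD; first exact: rP.
rewrite {1}(row_sum_delta w) linear_sum mulr_suml.
apply: le_trans (ler_norm_sum _ _ _) _; apply: ler_sum => a _.
by rewrite linearZ /= normrZ mulrC ler_wpM2l // norm_coord_le.
Qed.

End Jets.

(** * The vector field at one point *)

Section Pointwise.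
Variables (K : numFieldType) (n p N : nat).
Hypothesis mean_value : mean_value_property K.
Local Notation V := 'rV[K]_n.
Local Notation W := (N.-bseq 'I_n).
Variables (x : V) (X : V -> V) (F : V -> 'rV[K]_p) (cX : 'I_n -> W -> K).
Hypothesis jX : forall a, jet x (fun y => X y 0 a) (cX a).
Variables (L r : K).
Hypotheses (L0 : 0 <= L) (r0 : 0 < r).
Hypothesis FX : forall y, `|y - x| < r ->
  [/\ differentiable F y, 'd F y (X y) = 0 & forall v, `|'d F y v| <= L * `|v|].

(** Since [dF] kills [X], the derivative of [F] along the curve is [dF] applied to the defect
    [g' - X(g)], which is of order [N]. The mean value inequality gains one order. *)
Lemma curve_fiber (g : 'I_n -> {poly K}) : (forall a, (g a)`_0 = x 0 a) ->
  (forall a, eqlow N (g a)^`() (psum (cX a) g)) ->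
  orderO N.+1 (fun t => `|F (curve g t) - F x|).
Proof.
move=> g0 gQ.
pose G t := 'd (curve g) t 1 - X (curve g t).
have [e1 e10 [B B0 GB]] : orderO N (fun t => `|G t|).
  apply: orderO_row => a.
  apply: (@orderO_eq _ _ (fun t => ((g a)^`() - psum (cX a) g).[t] +
      (-1) * (X (curve g t) 0 a - (psum (cX a) g).[t]))).
    by move=> t; rewrite /G (diff_curve g t).2 !mxE hornerD hornerN; ring.
  apply: orderOD; first by apply: horner_orderO => i iN; rewrite coefB gQ // subrr.
  by apply: orderOZ; apply: (@orderO_le _ _ N.+1) => //; exact: jet_curve (jX a).
have [e2 e20 cr] := curve_near g0 r0.
have [e e0 [ee1 ee2]] := gt0_below e10 e20.
apply: orderO_row => b; exists e => //; exists (L * B) => [|t te]; first exact: mulr_ge0.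
pose f (z : K^o) : K^o := F (curve g z) 0 b.
have -> : (F (curve g t) - F x) 0 b = f (0 + t) - f 0 - 0.
  by rewrite subr0 add0r /f (curve0 g0) !mxE.
apply: (mean_value (V := K^o)) => s s01; rewrite add0r.
have st : `|s *: t| <= `|t|.
  by rewrite normrM ler_piMl //; case/andP: s01 => s0 s1; rewrite ger0_norm.
move: (s *: t) st => z zt; have ze := le_lt_trans zt te.
have [dc dc1] := diff_curve g z.
have [dF FX0 FL] := FX (cr z (lt_le_trans ze ee2)).
have dFc : differentiable (F \o curve g) z by exact: differentiable_comp.
have [df dfE] := diff_coord b dFc; split; first exact: df.
rewrite subr0 dfE (diff_comp dc dF) /=.
have -> : 'd (curve g) z t = t *: 'd (curve g) z 1.
  by rewrite -linearZ /= [t *: (1 : K^o)]mulr1.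
rewrite linearZ /= mxE normrM exprSr mulrA mulrC ler_wpM2r //.
have -> : 'd F (curve g z) ('d (curve g) z 1) = 'd F (curve g z) (G z).
  by rewrite /G linearB /= FX0 subr0.
apply: le_trans (norm_coord_le _ _) _; apply: le_trans (FL _) _.
rewrite -mulrA ler_wpM2l //.
have := GB z (lt_le_trans ze ee1); rewrite normr_id => /le_trans; apply.
by rewrite ler_wpM2l // lerXn2r ?nnegrE.
Qed.

Variables (E : 'I_N -> V -> K) (cE : 'I_N -> W -> K).
Hypothesis jE : forall i, jet x (E i) (cE i).
Variables (coef : W -> 'I_N -> K) (l : W -> nat).
Variables (psi : forall w, 'I_(l w) -> 'rV[K]_p -> K^o) (h : forall w, 'I_(l w) -> V -> K).
Variables (ch : forall w, 'I_(l w) -> W -> K) (Ch : forall w, 'I_(l w) -> K).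
Hypothesis jh : forall w j, jet x (@h w j) (@ch w j).
Hypothesis chC : forall w j w', `|@ch w j w'| <= @Ch w j.
Hypothesis psi_diff : forall w j, differentiable (@psi w j) (F x).
Hypothesis monE : forall y, `|y - x| < r -> forall w : W,
  mon w y = \sum_i coef w i * E i y + \sum_j @psi w j (F y) * @h w j y.
Hypothesis small : \sum_w \sum_j `|@psi w j (F x)| * @Ch w j < 1.

(** One [N] plays two roles: the [N] jets of [E] leave a nonzero functional on [N + 1] coefficients,
    and the powers of a coordinate up to the exponent [N] detect that functional. *)
Lemma vector_field_eq0 : X x = 0.
Proof.
(* [curve_fiber] asks for order [N]; the extra order makes the first coefficient of [g] equal to
   [X x] even when [N = 0]. *)
have [g [g0 gQ]] := formal_curve cX x N.+1.
have Fc := curve_fiber g0 (fun a => eqlow_le (leqnSn N) (gQ a)).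
have [lam [[i0 li0] lamE]] := exists_functional (fun i k => (psum (cE i) g)`_k).
pose Lam := pairing lam.
have psiO w j : orderO N.+1 (fun t => @psi w j (F (curve g t)) - @psi w j (F x)).
  have [L' L'0 [r' r'0 psiL]] := differentiable_lipschitz (psi_diff j).
  have [e e0 [B B0 FB]] := Fc.
  have q0 : 0 < r' / (B + 1) by rewrite divr_gt0 // ltr_wpDl.
  have [e1 e10 [e1e e1q]] := gt0_below e0 q0.
  have [e2 e20 [e21 e2o]] := gt0_below e10 (@ltr01 K).
  exists e2 => //; exists (L' * B) => [|t te]; first exact: mulr_ge0.
  have := FB t (lt_le_trans te (le_trans e21 e1e)); rewrite normr_id => h1.
  have h2 : `|F (curve g t) - F x| < r'.
    apply: le_lt_trans h1 _.
    have tq : `|t| < r' / (B + 1) by apply: lt_le_trans te (le_trans e21 e1q).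
    rewrite ltr_pdivlMr ?ltr_wpDl // in tq; apply: le_lt_trans tq.
    rewrite mulrC; apply: (@le_trans _ _ (`|t| * B)); last first.
      by rewrite ler_wpM2l // lerDl.
    rewrite ler_wpM2r // exprS ler_piMr // exprn_ile1 // ltW //.
    exact: lt_le_trans te e2o.
  have := psiL _ h2; rewrite [F x + _]addrC subrK => /le_trans; apply.
  by rewrite -mulrA ler_wpM2l.
have hO w j : orderO 0 (fun t => @h w j (curve g t)).
  apply: (@orderO_eq _ _ (fun t => (@h w j (curve g t) - (psum (@ch w j) g).[t]) +
     (psum (@ch w j) g).[t])); first by move=> t; rewrite subrK.
  apply: orderOD; last exact: horner_orderO.
  by apply: (@orderO_le _ _ N.+1) => //; exact: jet_curve (jh j).
have LamE (w : W) : Lam (pmon w g) = \sum_j @psi w j (F x) * Lam (psum (@ch w j) g).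
  (* The expansion of the monomial along the curve, with [E] and [h] replaced by their jets and
     [psi] frozen at [F x]. The error has order [N + 1], so all coefficients seen by [Lam]
     vanish. *)
  pose D : {poly K} := pmon w g - \sum_i coef w i *: psum (cE i) g -
    \sum_j @psi w j (F x) *: psum (@ch w j) g.
  have DO : orderO N.+1 (horner D).
    have [e e0 er] := curve_near g0 r0.
    have [d d0 [B B0 DB]] : orderO N.+1 (fun t =>
        \sum_i coef w i * (E i (curve g t) - (psum (cE i) g).[t]) +
        \sum_j ((@psi w j (F (curve g t)) - @psi w j (F x)) * @h w j (curve g t) +
          @psi w j (F x) * (@h w j (curve g t) - (psum (@ch w j) g).[t]))).
      apply: orderOD.
        by apply: orderO_sum => i; apply: orderOZ; exact: jet_curve (jE i).
      apply: orderO_sum => j; apply: orderOD.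
        by rewrite -(addn0 N.+1); exact: orderOM.
      by apply: orderOZ; exact: jet_curve (jh j).
    have [q q0 [qe qd]] := gt0_below e0 d0.
    exists q => //; exists B => // t tq.
    have -> : D.[t] = \sum_i coef w i * (E i (curve g t) - (psum (cE i) g).[t]) +
        \sum_j ((@psi w j (F (curve g t)) - @psi w j (F x)) * @h w j (curve g t) +
          @psi w j (F x) * (@h w j (curve g t) - (psum (@ch w j) g).[t])).
      rewrite /D !hornerD !hornerN horner_pmon !horner_sum -/(curve g t).
      rewrite (monE (er t (lt_le_trans tq qe))).
      under [X in _ - X - _]eq_bigr do rewrite hornerZ.
      under [X in _ - _ - X]eq_bigr do rewrite hornerZ.
      under [X in _ = X + _]eq_bigr do rewrite mulrBr.
      under [X in _ = _ + X]eq_bigr => j _.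
        rewrite (_ : _ + _ = @psi w j (F (curve g t)) * @h w j (curve g t) -
          @psi w j (F x) * (psum (@ch w j) g).[t]); last by ring.
        over.
      rewrite !sumrB; ring.
    exact: DB (lt_le_trans tq qd).
  have : Lam D = 0.
    transitivity (Lam 0); last by rewrite /Lam -(scale0r (0 : {poly K})) pairingZ mul0r.
    apply: pairing_eqlow => i iN.
    by rewrite coef0 (orderO_coef0 DO).
  have LamB a b : Lam (a - b) = Lam a - Lam b.
    by rewrite /Lam pairingD -(scaleN1r b) pairingZ mulN1r.
  rewrite /D !LamB /Lam !pairing_sum.
  rewrite [X in _ - X - _]big1 => [|i _]; last by rewrite pairingZ /pairing lamE mulr0.
  rewrite subr0 => /subr0_eq ->; apply: eq_bigr => j _; exact: pairingZ.
pose M := \sum_(w : W) `|Lam (pmon w g)|.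
have LamC w j : `|Lam (psum (@ch w j) g)| <= @Ch w j * M.
  rewrite /Lam pairing_sum mulr_sumr; apply: le_trans (ler_norm_sum _ _ _) _.
  by apply: ler_sum => w' _; rewrite pairingZ normrM ler_wpM2r.
have M0 : M = 0.
  (* Bounding each [Lam] of a jet of [h] by [Ch * M] turns [LamE] into [M <= eps * M] with
     [eps < 1]. *)
  apply/eqP; apply: contraT => Mn0.
  have Mp : 0 < M by rewrite lt_def Mn0 sumr_ge0.
  have : M <= (\sum_w \sum_j `|@psi w j (F x)| * @Ch w j) * M.
    rewrite mulr_suml; apply: ler_sum => w _; rewrite LamE.
    apply: le_trans (ler_norm_sum _ _ _) _; rewrite mulr_suml; apply: ler_sum => j _.
    by rewrite normrM -mulrA ler_wpM2l.
  by rewrite -[X in X <= _]mul1r ler_pM2r // => /le_lt_trans/(_ small); rewrite ltxx.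
have Lam0 (w : W) : Lam (pmon w g) = 0.
  by apply/eqP; rewrite -normr_eq0; apply/eqP; apply: (psumr_eq0P _ M0).
apply/rowP => b; rewrite [RHS]mxE; apply/eqP; apply: contraT => Xb.
have g1 : (g b)`_1 != 0.
  have -> : (g b)`_1 = ((g b)^`())`_0 by rewrite coef_deriv.
  rewrite gQ // -horner_coef0 horner_psum -/(curve g 0) (curve0 g0).
  have [C C0 [e e0 eP]] := jX b.
  have := eP x; rewrite subrr normr0 expr0n mulr0 => /(_ e0).
  by rewrite normr_le0 subr_eq0 => /eqP <-.
have lam0 := pairing_expr_eq0 g1 (lam := lam).
case/negP: li0; apply/eqP; apply: lam0 => i iN.
have sw : (size (nseq i b) <= N)%N by rewrite size_nseq.
by have := Lam0 (Bseq sw); rewrite /Lam /pmon /= big_nseq iter_mulr_1.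
Qed.
End Pointwise.

(** * Vanishing of the vector field *)

Lemma near_forall2 (T : topologicalType) (s : T) (I : finType) (J : I -> finType)
    (P : forall i, J i -> T -> Prop) :
  (forall i j, \forall x \near s, P i j x) ->
  \forall x \near s, forall i j, P i j x.
Proof.
move=> Ps; apply: (@filter_forall _ _ (fun i => [set x | forall j, P i j x])) => i.
by apply: (@filter_forall _ _ (fun j => [set x | P i j x])) => j; exact: Ps.
Qed.

Lemma near_forall (T : topologicalType) (s : T) (I : finType) (P : I -> T -> Prop) :
  (forall i, \forall x \near s, P i x) -> \forall x \near s, forall i, P i x.
Proof.
by move=> Ps; apply: (@filter_forall _ _ (fun i => [set x | P i x])) => i; exact: Ps.
Qed.

Section Local.
Variables (K : numFieldType) (n p N : nat).
Hypothesis mean_value : mean_value_property K.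
Local Notation V := 'rV[K]_n.
Local Notation W := (N.-bseq 'I_n).

Definition Cinfty_at (s : V) (h : V -> K^o) : Prop :=
  exists U : set V, [/\ open U, U s & Cinfty U h].

Variables (s : V) (X : V -> V) (F : V -> 'rV[K]_p).
Hypothesis XC : forall a, Cinfty_at s (fun y => X y 0 a).
Hypothesis FC : forall b, Cinfty_at s (fun y => F y 0 b).
Hypothesis dF : \forall y \near s, differentiable F y.
Hypothesis FX : \forall y \near s, 'd F y (X y) = 0.

Lemma near_diff_bound : exists2 L : K, 0 <= L &
  \forall y \near s, forall v, `|'d F y v| <= L * `|v|.
Proof.
have bound a b : exists2 L : K, 0 <= L &
    \forall y \near s, `|partial a (fun y => F y 0 b) y| <= L.
  have [U [oU Us hU]] := FC b.
  have [r r0 rP] := near_bounded (Cinfty_partial a hU 0%N s Us).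
  eexists; last by apply/nbhs_normP; exists r => // x /=; rewrite distrC; exact: rP.
  by rewrite addr_ge0.
pose L a b := sval (cid2 (bound a b)).
have LP a b : 0 <= L a b /\ \forall y \near s, `|partial a (fun y => F y 0 b) y| <= L a b.
  by rewrite /L; case: cid2.
have L0 a b : 0 <= L a b by have [] := LP a b.
exists (\sum_a \sum_b L a b); first by do 2 (apply: sumr_ge0 => ? _).
have Lb : \forall y \near s, forall a b, `|partial a (fun y => F y 0 b) y| <= L a b.
  by apply: near_forall2 => a b; have [] := LP a b.
apply: filterS2 dF Lb => y dFy Ly v.
apply: norm_row_le => [|b].
  by rewrite mulr_ge0 //; do 2 (apply: sumr_ge0 => ? _).
have [db <-] := diff_coord b dFy; rewrite (diff_partial _ db).
apply: le_trans (ler_norm_sum _ _ _) _; rewrite mulr_suml; apply: ler_sum => a _.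
rewrite normrM mulrC ler_pM // ?norm_coord_le //.
by apply: le_trans (Ly a b) _; rewrite (bigD1 b) //= lerDl sumr_ge0.
Qed.

Variables (E : 'I_N -> V -> K^o) (coef : W -> 'I_N -> K) (l : W -> nat).
Hypothesis EC : forall i, Cinfty_at s (E i).
Variables (psi : forall w, 'I_(l w) -> 'rV[K]_p -> K^o) (h : forall w, 'I_(l w) -> V -> K^o).
Hypothesis hC : forall w j, Cinfty_at s (@h w j).
Hypothesis psi_diff : forall w j, \forall z \near F s, differentiable (@psi w j) z.
Hypothesis psi0 : forall w j, @psi w j (F s) = 0.
Hypothesis monE : \forall y \near s, forall w : W,
  mon w y = \sum_i coef w i * E i y + \sum_j @psi w j (F y) * @h w j y.

Lemma vector_field_near0 : \forall x \near s, X x = 0.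
Proof.
have jets g : Cinfty_at s g -> exists2 C : K, 0 <= C & \forall x \near s,
    exists2 c : W -> K, (forall w, `|c w| <= C) & jet x g c.
  by move=> [U [oU Us gU]]; exact: taylor_near oU Us gU.
have nE : \forall x \near s, forall i, exists c : W -> K, jet x (E i) c.
  apply: near_forall => i; have [C _ hx] := jets _ (EC i).
  by apply: filterS hx => x [c _ jc]; exists c.
have nX : \forall x \near s, forall a, exists c : W -> K, jet x (fun y => X y 0 a) c.
  apply: near_forall => a; have [C _ hx] := jets _ (XC a).
  by apply: filterS hx => x [c _ jc]; exists c.
(* These bounds are fixed before [x] is chosen, because how close [x] must be to [s] depends on
   them. *)
pose Ch w j := sval (cid2 (jets _ (@hC w j))).
have ChP w j : 0 <= Ch w j /\ \forall x \near s,
    exists2 c : W -> K, (forall w', `|c w'| <= Ch w j) & jet x (@h w j) c.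
  by rewrite /Ch; case: cid2.
have nh : \forall x \near s, forall w j, exists2 c : W -> K,
    (forall w', `|c w'| <= Ch w j) & jet x (@h w j) c.
  by apply: near_forall2 => w j; have [] := ChP w j.
have [L L0 nL] := near_diff_bound.
(* The pointwise argument at [x] needs its hypotheses on a whole neighbourhood of [x], not only at
   [x]. *)
have nF : \forall x \near s, \forall y \near x,
    [/\ differentiable F y, 'd F y (X y) = 0 & forall v, `|'d F y v| <= L * `|v|].
  by apply: near_join; apply: filterS3 dF FX nL => y.
have nM : \forall x \near s, \forall y \near x, forall w : W,
    mon w y = \sum_i coef w i * E i y + \sum_j @psi w j (F y) * @h w j y.
  exact: near_join.
have cF : {for s, continuous F}.
  by apply: differentiable_continuous; exact: nbhs_singleton dF.
have npsi : \forall x \near s, forall w j, differentiable (@psi w j) (F x).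
  by apply: near_forall2 => w j; exact: cF (psi_diff j).
pose S := \sum_w \sum_j Ch w j.
have S0 : 0 <= S.
  by apply: sumr_ge0 => w _; apply: sumr_ge0 => j _; have [] := ChP w j.
have nsmall : \forall x \near s, \sum_w \sum_j `|@psi w j (F x)| * Ch w j < 1.
  (* Each [psi] tends to 0 as [x] tends to [s]; once all are below [1 / (S + 1)], the sum is at most
     [S / (S + 1)]. *)
  have d0 : 0 < (S + 1)^-1 by rewrite invr_gt0 ltr_wpDl.
  have : \forall x \near s, forall w j, `|@psi w j (F x)| < (S + 1)^-1.
    apply: near_forall2 => w j.
    have cpsi : {for F s, continuous (@psi w j)}.
      by apply: differentiable_continuous; exact: nbhs_singleton (psi_diff j).
    have /cvgrPdist_lt/(_ _ d0) : (@psi w j \o F) x @[x --> s] --> @psi w j (F s).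
      exact: (@continuous_comp _ _ _ F (@psi w j) s cF cpsi).
    apply: filterS => x /=; rewrite psi0 sub0r normrN => hx; exact: hx.
  apply: filterS => x psix.
  apply: (@le_lt_trans _ _ ((S + 1)^-1 * S)); last first.
    by rewrite mulrC ltr_pdivrMr ?ltr_wpDl // mul1r ltrDl.
  rewrite mulr_sumr; apply: ler_sum => w _; rewrite mulr_sumr; apply: ler_sum => j _.
  by rewrite ler_wpM2r //; [have [] := ChP w j | exact: ltW].
near=> x.
have /choice[cE jE] : forall i, exists c : W -> K, jet x (E i) c by near: x.
have /choice[cX jX] : forall a, exists c : W -> K, jet x (fun y => X y 0 a) c by near: x.
have nhx : forall w j, exists2 c : W -> K,
    (forall w', `|c w'| <= Ch w j) & jet x (@h w j) c by near: x.
pose ch w j := sval (cid2 (nhx w j)).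
have chP w j : (forall w', `|ch w j w'| <= Ch w j) /\ jet x (@h w j) (ch w j).
  by rewrite /ch; case: cid2.
have nFM : \forall y \near x,
    [/\ differentiable F y, 'd F y (X y) = 0 & forall v, `|'d F y v| <= L * `|v|] /\
    forall w : W, mon w y = \sum_i coef w i * E i y + \sum_j @psi w j (F y) * @h w j y.
  by near: x; apply: filterS2 nF nM => x; apply: filterS2.
have [r r0 rP] := near_radius nFM.
apply: (@vector_field_eq0 K n p N mean_value x X F cX jX L r L0 r0 _ E cE jE
  coef l psi h ch Ch).
- by move=> y /rP[].
- by move=> w j; have [] := chP w j.
- by move=> w j; have [] := chP w j.
- by near: x.
- by move=> y /rP[].
- by near: x.
Unshelve. all: by end_near. Qed.

End Local.

(** * Smooth germs *)

Section Ck.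
Variables (K : numFieldType) (n : nat).
Local Notation V := 'rV[K]_n.
Implicit Types (U : set V).

Lemma Ck_succ (W : normedModType K) m U (f : V -> W) : Ck m.+1 U f -> Ck m U f.
Proof.
elim: m f => [|m IH] f [df Df].
  by move=> x Ux; apply: differentiable_continuous; exact: df.
by split=> // v; apply: IH; exact: Df.
Qed.

Lemma Ck_coord p m U (G : V -> 'rV[K]_p) a : open U -> Ck m U G ->
  Ck m U (fun y => G y 0 a : K^o).
Proof.
move=> oU; elim: m G => [|m IH] G.
  move=> cG x Ux; apply: (@continuous_comp _ _ _ G (fun M : 'rV[K]_p => M 0 a : K^o)).
    exact: cG.
  exact: coord_continuous.
move=> [dG DG]; split=> [x Ux|v]; first by have [] := diff_coord a (dG x Ux).
apply: (Ck_eq oU _ (IH _ (DG v))) => x Ux.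
have [dGa dGE] := diff_coord a (dG x Ux).
by rewrite (deriveE _ (dG x Ux)) (deriveE _ dGa) dGE.
Qed.

Lemma Ck_mul m U (f g : V -> K^o) : open U -> Ck m U f -> Ck m U g ->
  Ck m U (fun y => f y * g y : K^o).
Proof.
move=> oU; elim: m f g => [|m IH] f g.
  by move=> cf cg x Ux; apply: (@continuousM K V f g); [exact: cf | exact: cg].
move=> hf hg; have [df Df] := hf; have [dg Dg] := hg; split=> [x Ux|v].
  by apply: (@differentiableM K V f g); [exact: df | exact: dg].
have h1 : Ck m U (fun y => f y * 'D_v g y : K^o) by apply: IH; [exact: Ck_succ | exact: Dg].
have h2 : Ck m U (fun y => g y * 'D_v f y : K^o) by apply: IH; [exact: Ck_succ | exact: Df].
apply: (Ck_eq oU _ (Ck_lin 1 oU h1 h2)) => x Ux.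
rewrite !fctE (@deriveM _ _ f g); first by rewrite scale1r.
- exact/diff_derivable/df.
- exact/diff_derivable/dg.
Qed.

Lemma Ck_mon m (w : seq 'I_n) : Ck m setT (mon w : V -> K^o).
Proof.
elim: w => [|a w IH].
  rewrite (_ : mon [::] = cst 1); first exact: Ck_cst.
  by apply/funext => y; rewrite /mon big_nil.
rewrite (_ : mon (a :: w) = fun y => y 0 a * mon w y : K^o); last first.
  by apply/funext => y; rewrite /mon big_cons.
apply: Ck_mul => //; first exact: openT.
apply: Ck_coord; first exact: openT.
case: m {IH} => [|m]; first by move=> x _; exact: cvg_id.
split=> [x _|v]; first exact: ex_diff.
by rewrite (_ : (fun x => _) = cst v); [exact: Ck_cst | apply/funext => x; exact: derive_id].
Qed.

Lemma differentiable_Cinfty U (f : V -> K^o) : mean_value_property K ->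
  cauchy_property K -> almost_linear_property K -> open U ->
  (forall x, U x -> differentiable f x) -> Cinfty U f.
Proof.
move=> mv cy al oU df m; elim: m f df => [|m IH] f df /=.
  by move=> x Ux; apply: differentiable_continuous; exact: df.
by split=> // v; apply: IH => x Ux; exact: differentiable_derive Ux.
Qed.

End Ck.

Section SmoothScalars.
Variables (R : realType) (k : scalar_kind) (n : nat).
Local Notation K := (scalars R k).
Local Notation V := 'rV[K]_n.

(** Here the two kinds of scalars merge: a holomorphic function has complex derivatives of all
    orders, by iterating [differentiable_derive]. *)
Lemma smooth_on_Cinfty (U : set V) (f : V -> K^o) : open U -> smooth_on k U f -> Cinfty U f.
Proof.
case: k U f => //= U f oU df; apply: differentiable_Cinfty => //.
- exact: (@mean_value_segment R ComplexScalars).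
- exact: (@diff_bound R).
- exact: (@almost_linear R).
Qed.

Lemma smooth_on_coord p (U : set V) (G : V -> 'rV[K]_p) a : open U -> smooth_on k U G ->
  smooth_on k U (fun y => G y 0 a : K^o).
Proof.
case: k U G => /= U G oU sG; first by move=> m; exact: Ck_coord.
by move=> x Ux; have [] := diff_coord a (sG x Ux).
Qed.

Lemma smooth_on_mon (w : seq 'I_n) : smooth_on k setT (mon w : V -> K^o).
Proof.
case: k => /=; first by move=> m; exact: Ck_mon.
by move=> x _; have [+ _] := @Ck_mon (scalars R ComplexScalars) n 1 w; exact.
Qed.

Lemma smooth_near_Cinfty_at (S : set V) (h : V -> K^o) s :
  smooth_near S h -> S s -> Cinfty_at s h.
Proof.
move=> [U [oU SU sh]] Ss; exists U; split=> //; first exact: SU.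
exact: smooth_on_Cinfty.
Qed.

End SmoothScalars.

Lemma lmod_quot_sum (K : pzRingType) (V : lmodType K) (I : zmodClosed V)
    (IZ : GRing.scaler_closed I) d (c : 'I_d -> K) (v : 'I_d -> V) :
  \sum_i c i *: (\pi_(lmod_quot IZ) (v i)) = \pi_(lmod_quot IZ) (\sum_i c i *: v i).
Proof.
have piD : {morph \pi_(lmod_quot IZ) : x y / x + y} by exact: (@Quotient.pi_add _ I).
have pi0 : \pi_(lmod_quot IZ) 0 = 0.
  by apply: (addrI (\pi_(lmod_quot IZ) 0)); rewrite -piD !addr0.
rewrite (big_morph _ piD pi0); apply: eq_bigr => i _.
exact: esym (pi_scale IZ _ _).
Qed.

Lemma germ_of_sum (T : topologicalType) (S : set T) (W : zmodType) (I : Type) (l : seq I)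
    (F : I -> T -> W) :
  germ_of S (fun x => \sum_(i <- l) F i x) = \sum_(i <- l) germ_of S (F i).
Proof.
rewrite -(big_morph _ (@germ_ofD _ S W) (germ_of0 S W)).
by congr germ_of; apply/funext => x; rewrite fct_sumE.
Qed.

(** * Expansions modulo the ideal *)

Section FiniteCodimension.
Variables (R : realType) (k : scalar_kind) (n p : nat).
Local Notation K := (scalars R k).
Variables (S : set 'rV[K]_n) (f : smooth_germ S 'rV[K]_p).
Hypothesis hdelta : (delta f < +oo)%E.

(** A value below [+oo] excludes the empty infimum, so [Q(f)] has a finite basis, which is lifted to
    function-germs. *)
Lemma finite_delta_basis : exists (d : nat) (e : 'I_d -> smooth_germ S K^o),
  forall g : smooth_germ S K^o, exists c : 'I_d -> K,
    g - \sum_i c i *: e i \in pullback_ideal f.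
Proof.
move: hdelta; rewrite /delta /dim => /ereal_inf_lt[_ [d [e [span _]] <-] _].
exists d, (fun i => repr (e i)) => g.
have [c gE] := span (\pi_(Q_alg f) g); exists c.
rewrite Quotient.idealrBE; apply/eqP; rewrite -[LHS]/(\pi_(Q_alg f) g) gE.
rewrite -[RHS](lmod_quot_sum (@pullback_ideal_scaler_closed R k n p S f)).
by apply: eq_bigr => i _; rewrite -[in LHS](reprK (e i)).
Qed.

(** Membership in the ideal is an equality of germs; it is rewritten as an identity between
    representatives near each point of [S]. *)
Lemma near_expansion d (e : 'I_d -> smooth_germ S K^o) (g : smooth_germ S K^o)
    (c : 'I_d -> K) :
  g - \sum_i c i *: e i \in pullback_ideal f ->
  exists (l : nat) (psi : 'I_l -> smooth_germ [set 0 : 'rV[K]_p] K^o)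
    (h : 'I_l -> smooth_germ S K^o),
  (forall j, germ_val (val (psi j)) 0 = 0) /\
  forall G : 'rV[K]_n -> K^o, germ_of S G = val g ->
  forall s, S s -> \forall y \near s,
    G y = \sum_i c i * repr (val (e i)) y +
      \sum_j repr (val (psi j)) (repr (val f) y) * repr (val (h j)) y.
Proof.
move=> /asboolP[l [psi [h [psi0 gE]]]]; exists l, psi, h; split=> // G GE s Ss.
suff /eq_germP : germ_of S G = germ_of S (fun y => \sum_i c i * repr (val (e i)) y +
      \sum_j repr (val (psi j)) (repr (val f) y) * repr (val (h j)) y : K^o).
  by move=> /(_ s Ss).
have -> : germ_of S (fun y => \sum_i c i * repr (val (e i)) y +
      \sum_j repr (val (psi j)) (repr (val f) y) * repr (val (h j)) y : K^o) =
  germ_of S (fun y => \sum_i c i * repr (val (e i)) y : K^o) +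
  germ_of S (fun y => \sum_j repr (val (psi j)) (repr (val f) y) * repr (val (h j)) y : K^o).
  by rewrite -germ_ofD.
rewrite (germ_of_sum S (index_enum 'I_d) (fun i y => c i * repr (val (e i)) y : K^o)).
rewrite (germ_of_sum S (index_enum 'I_l)
  (fun j y => repr (val (psi j)) (repr (val f) y) * repr (val (h j)) y : K^o)).
have valB (u v : smooth_germ S K^o) : val (u - v) = val u - val v by exact: (raddfB val).
have valS : val (\sum_i c i *: e i) = \sum_i c i *: val (e i).
  by rewrite (raddf_sum val); apply: eq_bigr.
transitivity (\sum_i c i *: val (e i) + val (g - \sum_i c i *: e i)).
  by rewrite GE valB valS addrC subrK.
rewrite gE; congr (_ + _).
apply: eq_bigr => i _.
rewrite -{1}(germ_ofK (val (h i))) /pullback mul_germE.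
by [].
Qed.
End FiniteCodimension.

Section Main.
Variables (R : realType) (k : scalar_kind) (n p : nat).
Local Notation K := (scalars R k).

(** The points of [S] are treated one at a time: it suffices that a representative of [xi - eta]
    vanishes near each of them. The expansions of the monomials come from the basis of [Q(f)]. *)
Lemma tf_injective (S : set 'rV[K]_n) (f : smooth_germ S 'rV[K]_p) :
  (forall s, S s -> germ_val (val f) s = 0) -> (delta f < +oo)%E ->
  injective (tf f).
Proof.
move=> f0 hdelta xi eta /eq_germP tfE; apply: val_inj.
rewrite -(germ_ofK (val xi)) -(germ_ofK (val eta)); apply/eq_germP => s Ss.
pose F := repr (val f); pose X := repr (val (xi - eta)).
have XE : \forall y \near s, X y = repr (val xi) y - repr (val eta) y.
  suff /eq_germP : germ_of S X = germ_of S (repr (val xi) - repr (val eta)).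
    by move=> /(_ s Ss).
  have germ_ofB (u v : 'rV[K]_n -> 'rV[K]_n) : germ_of S (u - v) = germ_of S u - germ_of S v.
    by apply: (addIr (germ_of S v)); rewrite -germ_ofD !subrK.
  have valB : val (xi - eta) = val xi - val eta by exact: (raddfB val).
  by rewrite germ_ofB /X !germ_ofK valB.
have Fs : F s = 0 by exact: f0.
have [N [e eP]] := finite_delta_basis hdelta.
have mon_smooth (w : seq 'I_n) :
    germ_of S (mon w : 'rV[K]_n -> K^o) \in @smooth_germs R k _ S K^o.
  apply/asboolP; exists (mon w) => //; exists setT; split=> //; first exact: openT.
  exact: smooth_on_mon.
(* The number of terms depends on the monomial, so the coefficients and the two families are packed
   into one dependent tuple before choosing. *)
have /choice[D DP] : forall w : N.-bseq 'I_n, exists D : ('I_N -> K) *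
    {l : nat & (('I_l -> smooth_germ [set 0 : 'rV[K]_p] K^o) *
                ('I_l -> smooth_germ S K^o))%type},
    (forall j, germ_val (val ((projT2 D.2).1 j)) 0 = 0) /\
    \forall y \near s, mon w y = \sum_i D.1 i * repr (val (e i)) y +
      \sum_j repr (val ((projT2 D.2).1 j)) (F y) * repr (val ((projT2 D.2).2 j)) y.
  move=> w; pose mw : smooth_germ S K^o :=
    exist (fun g : germ S K^o => g \in @smooth_germs R k _ S K^o) _ (mon_smooth w).
  have [c cP] := eP mw.
  have [l [psi [h [psi0 E]]]] := near_expansion cP.
  by exists (c, existT _ l (psi, h)); split=> //=; exact: E.
have [U [oU SU sF]] := smooth_near_repr (valP f).
have dF : \forall y \near s, differentiable F y.
  have : nbhs s U by apply: open_nbhs_nbhs; split=> //; exact: SU.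
  by apply: filterS => y Uy; exact: smooth_on_differentiable sF Uy.
have coordC q (g : smooth_germ S 'rV[K]_q) a : Cinfty_at s (fun y => repr (val g) y 0 a : K^o).
  have [U' [oU' SU' sg]] := smooth_near_repr (valP g).
  exists U'; split=> //; first exact: SU'.
  by apply: smooth_on_Cinfty => //; exact: smooth_on_coord.
suff X0 : \forall y \near s, X y = 0.
  by apply: filterS2 XE X0 => y -> /eqP; rewrite subr_eq0 => /eqP.
apply: (@vector_field_near0 K n p N (@mean_value_segment R k) s X F _ _ dF _
  (fun i => repr (val (e i))) (fun w => (D w).1) (fun w => projT1 (D w).2) _
  (fun w j => repr (val ((projT2 (D w).2).1 j)))
  (fun w j => repr (val ((projT2 (D w).2).2 j)))).
- by move=> a; exact: coordC.
- by move=> b; exact: coordC.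
- apply: filterS2 XE (tfE s Ss) => y -> /= e1.
  by rewrite linearB /= e1 subrr.
- by move=> i; exact: smooth_near_Cinfty_at (smooth_near_repr (valP (e i))) Ss.
- by move=> w j; exact: smooth_near_Cinfty_at (smooth_near_repr (valP _)) Ss.
- move=> w j; rewrite Fs.
  have [U' [oU' SU' sg]] := smooth_near_repr (valP ((projT2 (D w).2).1 j)).
  have : nbhs (0 : 'rV[K]_p) U' by apply: open_nbhs_nbhs; split=> //; exact: SU'.
  by apply: filterS => y Uy; exact: smooth_on_differentiable sg Uy.
- by move=> w j; rewrite Fs; have [h _] := DP w; exact: h.
- by apply: near_forall => w; have [] := DP w.
Qed.

End Main.

Theorem proposition1 (R : realType) (k : scalar_kind) (n p r : nat)
    (S : set 'rV[scalars R k]_n) (hS : (S #= `I_r)%card)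
    (f : smooth_germ S 'rV[scalars R k]_p)
    (hf : forall s, S s -> germ_val (val f) s = 0)
    (hdelta : (delta f < +oo)%E) :
  injective (tf f).
Proof. exact: tf_injective. Qed.
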